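(* For every partition $\lambda=[\lambda_1,\lambda_2,\dots,\lambda_k]$ (with $\lambda_1\ge\dots\ge\lambda_k>0$) one has $$\boldsymbol{\Gamma}^+_{\lambda_1}\boldsymbol{\Gamma}^+_{\lambda_2}\cdots\boldsymbol{\Gamma}^+_{\lambda_k}\cdot 1=J^{(q,t)}_\lambda,\qquad\text{where}\quad \boldsymbol{\Gamma}^+_m:=[u^m]\,\boldsymbol{\nabla}^{-1}\boldsymbol{\Gamma}(u,q^m)\boldsymbol{\nabla}.$$
   Context: Let $\Lambda$ be the algebra of symmetric functions in $x_1,x_2,\dots$ over $\mathbb{Q}(q,t)$, $X=x_1+x_2+\cdots$, with $p_\mu,h_n,m_\mu$ the power-sum, complete homogeneous and monomial symmetric functions; all operators are extended coefficientwise to $\Lambda[v][[u]]$. Plethystic notation: for an expression $E$ in $q,t,u,v,x_1,x_2,\dots$ and $f\in\Lambda$, $f[E]$ is the image of $f$ under the algebra morphism $p_k\mapsto E(q^k,t^k,u^k,v^k,x_1^k,x_2^k,\dots)$. The Hall scalar product is $\langle p_\mu,p_\nu\rangle=\delta_{\mu\nu}z_\mu$ with $z_\mu=\prod_i m_i(\mu)!\,i^{m_i(\mu)}$ ($m_i(\mu)$ the number of parts equal to $i$), and $\langle f,g\rangle_{q,t}:=\langle f[X],g[X\tfrac{1-q}{1-t}]\rangle$. $\mathcal{P}_Z$ denotes multiplication by $\mathrm{Exp}[ZX]:=\sum_{n\ge0}h_n[ZX]$. For a partition $\lambda$ with Young diagram $\{(i,j):1\le i\le\ell(\lambda),1\le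 j\le\lambda_i\}$ and a cell $\Box=(i,j)$: arm $a(\Box)=\lambda_i-j$, leg $\ell(\Box)=\lambda'_j-i$, co-arm $a'(\Box)=j-1$, co-leg $\ell'(\Box)=i-1$. $J^{(q,t)}_\lambda$ is the integral form of the Macdonald polynomial: $J^{(q,t)}_\lambda=\prod_{\Box\in\lambda}(1-q^{a(\Box)}t^{\ell(\Box)+1})P_\lambda$, where $(P_\lambda)$ is the unique family with $P_\lambda=m_\lambda+\sum_{\mu<\lambda}c_{\lambda\mu}m_\mu$ (dominance order) that is pairwise orthogonal for $\langle\cdot,\cdot\rangle_{q,t}$. The operators $\boldsymbol{\nabla}$ and $\boldsymbol{\Delta}_v$ are defined by $\boldsymbol{\nabla}J^{(q,t)}_\lambda=(-1)^{|\lambda|}\prod_{\Box\in\lambda}q^{a'(\Box)}t^{-\ell'(\Box)}J^{(q,t)}_\lambda$ and $\boldsymbol{\Delta}_vJ^{(q,t)}_\lambda=\prod_{\Box\in\lambda}(1-vq^{a'(\Box)}t^{-\ell'(\Box)})J^{(q,t)}_\lambda$, and $\boldsymbol{\Gamma}(u,v):=\boldsymbol{\Delta}_{1/v}\,\mathcal{P}_{\frac{uv(1-t)}{1-q}}\,\boldsymbol{\Delta}_{1/v}^{-1}$ (an operator polynomial in $v$). $[u^m]$ denotes extraction of the coefficient of $u^m$. *)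

(* Defs.v *)
From HB Require Import structures.
From mathcomp Require Import all_boot all_order all_algebra.
From mathcomp Require Import finmap.
From mathcomp Require Import -(notations) monalg.
From mathcomp Require Import mpoly.

Set Implicit Arguments.
Unset Strict Implicit.
Unset Printing Implicit Defensive.

Import GRing.Theory.
Local Open Scope ring_scope.

(** * Symmetric functions and plethysm *)

(* Symmetric functions over R (in the sequel R contains rat) are represented
   as polynomials in the power sums p_1, p_2, ...: the generator of index k of
   this polynomial ring stands for p_{k+1}.  The link with the variables
   x_1, x_2, ... is the restriction [inVars n f] to n variables, for all n. *)
Definition symfun (R : comNzRingType) : Type := malg (cmonom nat) R.

HB.instance Definition _ (R : comNzRingType) :=
  GRing.ComAlgebra.copy (symfun R) (malg (cmonom nat) R).

Section Plethysm.
Variables (S : comNzRingType) (phi : nat -> S).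

Definition pleth_mon (m : cmonom nat) : S :=
  \prod_(i <- finsupp m) phi i.+1 ^+ m i.

Lemma pleth_monEw (d : {fset nat}) (m : cmonom nat) : fsubset (finsupp m) d ->
  pleth_mon m = \prod_(i <- d) phi i.+1 ^+ m i.
Proof.
move=> le; rewrite /pleth_mon (big_fset_incl _ le) //.
by move=> i _; rewrite -cmE_neq0 negbK => /eqP ->.
Qed.

Lemma pleth_mon_morphism : mmorphism pleth_mon.
Proof.
split=> [m1 m2|]; last by rewrite /pleth_mon mdom1 big_seq_fset0.
rewrite (@pleth_monEw (finsupp m1 `|` finsupp m2)%fset (mul m1 m2)) ?mdomD //.
rewrite (pleth_monEw (fsubsetUl (finsupp m1) (finsupp m2))).
rewrite (pleth_monEw (fsubsetUr (finsupp m1) (finsupp m2))).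
by rewrite -big_split; apply: eq_bigr => i _; rewrite cmM exprD.
Qed.

HB.instance Definition _ :=
  isMultiplicative.Build (cmonom nat) S pleth_mon pleth_mon_morphism.

Variable R : comNzRingType.

(* f |-> f[E], where phi k is the image E(q^k, t^k, u^k, v^k, x_1^k, ...) of
   p_k for k >= 1; the scalars of f are sent to S by iota. *)
Definition pleth (iota : R -> S) : symfun R -> S :=
  monalg.mmap iota pleth_mon.

HB.instance Definition _ (iota : {rmorphism R -> S}) :=
  GRing.RMorphism.copy (pleth iota) (monalg.mmap iota pleth_mon).

(* p_k, for k >= 1 *)
Definition psum (k : nat) : symfun R := mkmalgU (ucm k.-1) 1.

Lemma pleth_psum (iota : {rmorphism R -> S}) k :
  (0 < k)%N -> pleth iota (psum k) = phi k.
Proof.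
case: k => // k _; rewrite /pleth mmapU /= rmorph1 mul1r.
by rewrite /pleth_mon mdomU big_seq_fset1 cmUU expr1.
Qed.

Lemma plethZ (iota : {rmorphism R -> S}) c f :
  pleth iota (c *: f) = iota c * pleth iota f.
Proof. exact: monalg.mmapZ. Qed.

End Plethysm.

Arguments psum {R} k.

(* The restriction f(x_1, ..., x_n, 0, 0, ...). *)
Definition inVars (R : comNzRingType) (n : nat) : symfun R -> {mpoly R[n]} :=
  pleth (fun k => \sum_(i < n) 'X_i ^+ k) (@mpolyC n R).

HB.instance Definition _ (R : comNzRingType) (n : nat) :=
  GRing.RMorphism.copy (@inVars R n)
    (pleth (fun k => \sum_(i < n) 'X_i ^+ k) (@mpolyC n R)).

Lemma inVarsZ (R : comNzRingType) n c (f : symfun R) :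
  inVars n (c *: f) = c *: inVars n f.
Proof. by rewrite /inVars plethZ mul_mpolyC. Qed.

Lemma inVars_psum (R : comNzRingType) n k :
  (0 < k)%N -> inVars n (psum k) = \sum_(i < n) 'X_i ^+ k :> {mpoly R[n]}.
Proof. exact: pleth_psum. Qed.

(* Pointwise image of the coefficients; fc should map 0 to 0. *)
Definition map_symfun (R S : comNzRingType) (fc : R -> S) (f : symfun R) :
    symfun S :=
  monalg.mmap (fun c => mkmalgU (one : cmonom nat) (fc c))
              (fun m => mkmalgU m 1) f.

(* The list [:: h_n; ...; h_1; h_0] of complete homogeneous symmetric
   functions, by Newton's identities n h_n = \sum_(1 <= k <= n) p_k h_(n-k);
   see inVars_hsym. *)
Fixpoint hsyms (R : fieldType) (n : nat) : seq (symfun R) :=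
  if n is n'.+1 then
    (n%:R^-1 *: \sum_(i < n) psum i.+1 * (hsyms R n')`_i) :: hsyms R n'
  else [:: 1].

Definition hsym (R : fieldType) (n : nat) : symfun R := (hsyms R n)`_0.

Lemma nth_hsyms (R : fieldType) n i :
  (i <= n)%N -> (hsyms R n)`_i = hsym R (n - i).
Proof.
elim: n i => [|n IH] [|i] //= le.
by rewrite IH // subSS.
Qed.

Lemma hsyms_cons (R : fieldType) n :
  hsyms R n.+1 = (n.+1%:R^-1 *: \sum_(i < n.+1) psum i.+1 * (hsyms R n)`_i)
                 :: hsyms R n.
Proof. reflexivity. Qed.

Lemma hsymS (R : fieldType) n :
  hsym R n.+1 =
    n.+1%:R^-1 *: \sum_(i < n.+1) psum i.+1 * hsym R (n - i).
Proof.
rewrite [LHS]/hsym hsyms_cons [nth _ _ _]/=.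
apply: (congr1 (GRing.scale _)); apply: eq_bigr => i _.
by rewrite nth_hsyms // -ltnS.
Qed.

(* h_k(x_1, ..., x_n), the sum of all monomials of degree k. *)
Definition compsym (R : comNzRingType) n k : {mpoly R[n]} :=
  \sum_(a : 'X_{1..n < k.+1} | mdeg a == k) 'X_[a].

Lemma mcoeff_compsym (R : comNzRingType) n k (b : 'X_{1..n}) :
  (compsym R n k)@_b = (mdeg b == k)%:R.
Proof.
rewrite /compsym raddf_sum /=; case: eqP => [<-|nb].
  rewrite (bigD1 (BMultinom (ltnSn (mdeg b)))) //= mcoeffX eqxx big1 ?addr0 //.
  move=> a /andP[_ ne]; rewrite mcoeffX; case: eqP => // ab; case/eqP: ne.
  by apply/val_inj.
rewrite big1 // => a /eqP da; rewrite mcoeffX; case: eqP => // ab.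
by case: nb; rewrite -ab.
Qed.

Lemma mcoeff_mulX (R : comNzRingType) n (p : {mpoly R[n]}) i k b :
  ('X_i ^+ k * p)@_b = if (k <= b i)%N then p@_(b - U_(i) *+ k) else 0.
Proof.
rewrite mpolyXn mulrC; case: leqP => h.
  have le : (U_(i) *+ k <= b)%MM.
    apply/mnm_lepP => j; rewrite mulmnE mnmE.
    by case: eqP => [<-|_]; rewrite ?mul1n.
  by rewrite -{1}(submK le) addmC mcoeffMX.
rewrite mcoeffM big1 // => -[a c] /= /eqP E; rewrite mcoeffX.
case: eqP => [ce|]; last by rewrite mulr0.
have := congr1 (fun m : 'X_{1..n} => m i) E; rewrite -ce mnmDE mulmnE mnmE.
by rewrite eqxx mul1n => Ei; move: h; rewrite Ei ltnNge leq_addl.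
Qed.

Lemma newton_compsym (R : comNzRingType) n k :
  \sum_(i < k.+1) (\sum_(j < n) 'X_j ^+ i.+1) * compsym R n (k - i) =
  k.+1%:R *: compsym R n k.+1.
Proof.
apply/mpolyP => b; rewrite mcoeffZ raddf_sum mcoeff_compsym /=.
under eq_bigr => i _.
  rewrite mulr_suml raddf_sum /=.
  under eq_bigr => j _ do rewrite mcoeff_mulX mcoeff_compsym.
  over.
rewrite exchange_big /=.
have dB (j : 'I_n) i : (i.+1 <= b j)%N -> (mdeg (b - U_(j) *+ i.+1) + i.+1 = mdeg b)%N.
  move=> h; have le : (U_(j) *+ i.+1 <= b)%MM.
    apply/mnm_lepP => l; rewrite mulmnE mnmE.
    by case: eqP => [<-|_]; rewrite ?mul1n.
  by rewrite -[in RHS](submK le) mdegD mdegMn mdeg1 mul1n.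
case: eqP => [db|nb]; last first.
  rewrite mulr0 big1 // => j _; rewrite big1 // => i _.
  case: ifP => // h; case: eqP => // e; case: nb.
  by rewrite -(dB _ _ h) e addnS subnK // -ltnS.
rewrite mulr1; transitivity ((mdeg b)%:R : R); last by rewrite db.
rewrite mdegE natr_sum; apply: eq_bigr => j _.
transitivity (\sum_(i < k.+1 | (i < b j)%N) (1 : R)).
  rewrite [RHS]big_mkcond /=. apply: eq_bigr => i _. case: ifP => // h.
  case: eqP => // e; case: e; apply: (@addIn i.+1).
  by rewrite dB // db addnS subnK // -ltnS.
have bj : (b j <= k.+1)%N by rewrite -db mdegE (bigD1 j) //= leq_addr.
by rewrite (big_ord_narrow bj) sumr_const card_ord.
Qed.

Lemma inVars_hsym (R : fieldType) (charR : forall k, k.+1%:R != 0 :> R) n k :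
  inVars n (hsym R k) = compsym R n k.
Proof.
elim/ltn_ind: k => -[_|k IH].
  rewrite rmorph1; apply/mpolyP => b.
  by rewrite mcoeff_compsym mcoeff1 mdeg_eq0.
rewrite hsymS inVarsZ rmorph_sum /=.
transitivity (k.+1%:R^-1 *: (k.+1%:R *: compsym R n k.+1)); last first.
  by rewrite scalerA mulVf // scale1r.
rewrite -newton_compsym; apply: (congr1 (GRing.scale _)).
by apply: eq_bigr => i _; rewrite rmorphM /= inVars_psum // IH // ltnS leq_subr.
Qed.

(** * Partitions *)

Definition is_part (la : seq nat) : bool :=
  sorted geq la && all (leq 1) la.

Definition conj_part (la : seq nat) (j : nat) : nat :=
  count (fun r => (j < r)%N) la.

(* Cells (i, j), 0-indexed: i is the co-leg and j the co-arm. *)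
Definition cells (la : seq nat) : seq (nat * nat) :=
  [seq (i, j) | i <- iota 0 (size la), j <- iota 0 (nth 0%N la i)].

Definition arm (la : seq nat) (b : nat * nat) : nat :=
  (nth 0 la b.1 - b.2.+1)%N.
Definition leg (la : seq nat) (b : nat * nat) : nat :=
  (conj_part la b.2 - b.1.+1)%N.
Definition coarm (b : nat * nat) : nat := b.2.
Definition coleg (b : nat * nat) : nat := b.1.

(* Strict dominance order mu < la. *)
Definition dom_lt (mu la : seq nat) : Prop :=
  [/\ mu != la, sumn mu = sumn la &
      forall k, (sumn (take k mu) <= sumn (take k la))%N].

(* The monomial symmetric polynomial m_mu(x_1, ..., x_n). *)
Definition monsym (R : comNzRingType) (n : nat) (mu : seq nat) :
    {mpoly R[n]} :=
  \sum_(a : 'X_{1..n < (sumn mu).+1} |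
        perm_eq [seq d <- (a : 'X_{1..n}) | d != 0%N] mu) 'X_[a].

(** * Coefficients *)

(* Q(q,t), as the fraction field of Q[q][t]. *)
Definition Kqt : fieldType := {fraction {poly {poly rat}}}.
Definition qK : Kqt := FracField.tofrac ('X%:P).
Definition tK : Kqt := FracField.tofrac 'X.

(* K(v) *)
Definition ratv (K : fieldType) : fieldType := {fraction {poly K}}.
Definition toKv {K : fieldType} (c : K) : ratv K := FracField.tofrac (c%:P).
Definition vv {K : fieldType} : ratv K := FracField.tofrac 'X.

(* The value at v = a of a rational function of v which is regular at a
   (see frac_eval_div): write it in lowest terms and evaluate. *)
Definition frac_eval (K : fieldType) (a : K) (x : ratv K) : K :=
  let n := \n_(repr x) in let d := \d_(repr x) in
  (n %/ gcdp n d).[a] / (d %/ gcdp n d).[a].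

Lemma frac_repr (R : idomainType) (x : {fraction R}) :
  x * FracField.tofrac (\d_(repr x)) = FracField.tofrac (\n_(repr x)).
Proof.
elim/quotW: x => r; set y := (\pi r)%qT.
rewrite -{1}[y]reprK; move: (repr y) => z.
rewrite !piE; apply/eqmodP; rewrite /= FracField.equivfE /FracField.mulf.
by rewrite !numden_Ratio ?oner_eq0 ?mulr1 ?denom_ratioP // mulrC.
Qed.

Lemma frac_eval_div (K : fieldType) (a : K) (p d : {poly K}) : d.[a] != 0 ->
  frac_eval a (FracField.tofrac p / FracField.tofrac d) = p.[a] / d.[a].
Proof.
move=> da; have d0 : d != 0 by apply: contra_neq da => ->; rewrite horner0.
set x := _ / _; rewrite /frac_eval.
have := frac_repr x; have := denom_ratioP (repr x).
move: (\n_(repr x)) (\d_(repr x)) => n e e0 xe; set g := gcdp n e.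
have E : n * d = p * e.
  apply/eqP; rewrite -tofrac_eq !tofracM -xe /x mulrAC.
  by rewrite divfK ?tofrac_eq0.
have g0 : g != 0 by rewrite gcdp_eq0 (negbTE e0) andbF.
have En : n = n %/ g * g by rewrite divpK ?dvdp_gcdl.
have Ee : e = e %/ g * g by rewrite divpK ?dvdp_gcdr.
have E' : n %/ g * d = p * (e %/ g).
  by apply: (mulIf g0); rewrite mulrAC -En -mulrA -Ee.
have cop : coprimep (e %/ g) (n %/ g).
  by rewrite coprimep_sym coprimep_div_gcd // e0 orbT.
have ea : (e %/ g).[a] != 0.
  have : e %/ g %| d by rewrite -(Gauss_dvdpr _ cop) E' dvdp_mull.
  by case/dvdpP=> k dE; move: da; rewrite dE hornerM mulf_eq0 negb_or => /andP[].
apply/eqP; rewrite eqr_div //.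
by move/(congr1 (horner^~ a)): E'; rewrite !hornerM => ->.
Qed.

(** * Power series in u *)

(* Power series in u are given by their sequence of coefficients. *)
Definition useries (A : Type) := nat -> A.

Definition series_map (A B : Type) (T : A -> B) (s : useries A) : useries B :=
  fun n => T (s n).
Definition series_const (A : nmodType) (f : A) : useries A :=
  fun n => if n == 0%N then f else 0.
Definition series_mul (A : pzRingType) (s1 s2 : useries A) : useries A :=
  fun n => \sum_(i < n.+1) s1 i * s2 (n - i)%N.

(* h_n[u Y X] in Lambda[u], where c k is the value of Y at the k-th powers of
   its parameters; the polynomial variable 'X is u. *)
Definition hsym_u (F : fieldType) (c : nat -> F) (n : nat) : {poly symfun F} :=
  pleth (fun k => (c k *: psum k)%:P * 'X^k)
        (polyC \o mkmalgU (one : cmonom nat)) (hsym F n).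

Lemma hsym_u_monomial (F : fieldType) (c : nat -> F) n :
  exists g, hsym_u c n = g%:P * 'X^n.
Proof.
rewrite /hsym_u; set phi := (X in pleth X); set iota := (X in pleth _ X).
elim/ltn_ind: n => -[_|n IH].
  by exists 1; rewrite rmorph1 expr0 mulr1.
rewrite hsymS plethZ rmorph_sum /=.
suff [g ->] : exists g,
    \sum_(i < n.+1) pleth phi iota (psum i.+1 * hsym F (n - i)) = g%:P * 'X^(n.+1).
  by exists (mkmalgU one n.+1%:R^-1 * g); rewrite mulrA polyCM.
elim/big_ind: _ => [|_ _ [g ->] [g' ->]|i _].
- by exists 0; rewrite mul0r.
- by exists (g + g'); rewrite polyCD mulrDl.
have [|g gE] := IH (n - i)%N; first by rewrite ltnS leq_subr.
exists (c i.+1 *: psum i.+1 * g).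
rewrite rmorphM /= pleth_psum // gE mulrACA -polyCM -exprD addSn subnKC //.
by rewrite -ltnS.
Qed.

(** * Macdonald polynomials *)

Section Macdonald.
Variables (K : fieldType) (q t : K).

(* z_mu for p_mu = \prod_i p_i ^ (m_i(mu)) *)
Definition zmon (m : cmonom nat) : K :=
  \prod_(i <- finsupp m) ((m i)`! * i.+1 ^ m i)%:R.

(* <p_mu, p_nu> = delta_{mu,nu} z_mu, extended bilinearly. *)
Definition hall (f g : symfun K) : K :=
  \sum_(m <- monalg.msupp f) monalg.mcoeff m f * monalg.mcoeff m g * zmon m.

(* <f, g>_{q,t} = <f, g[X (1-q)/(1-t)]> *)
Definition hall_qt (f g : symfun K) : K :=
  hall f (pleth (fun k => ((1 - q ^+ k) / (1 - t ^+ k)) *: psum k)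
                (mkmalgU (one : cmonom nat)) g).

(* P = m_la + \sum_(mu < la) c_mu m_mu.  As an identity between symmetric
   functions, it is read in every finite set of variables. *)
Definition dom_unitriangular (P : symfun K) (la : seq nat) : Prop :=
  exists (s : seq (seq nat)) (c : seq nat -> K),
    (forall mu, mu \in s -> is_part mu /\ dom_lt mu la) /\
    forall n, inVars n P =
      monsym _ n la + \sum_(mu <- s) c mu *: monsym _ n mu.

(* The family (P_la); only its values at partitions matter. *)
Definition is_macdonaldP (P : seq nat -> symfun K) : Prop :=
  (forall la, is_part la -> dom_unitriangular (P la) la) /\
  (forall la mu, is_part la -> is_part mu -> la != mu ->
     hall_qt (P la) (P mu) = 0).

(* The integral form. *)
Definition macdonaldJ (P : seq nat -> symfun K) (la : seq nat) : symfun K :=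
  (\prod_(b <- cells la) (1 - q ^+ arm la b * t ^+ (leg la b).+1)) *: P la.

Definition nabla_eigenvalue (la : seq nat) : K :=
  (-1) ^+ sumn la * \prod_(b <- cells la) (q ^+ coarm b * t ^- coleg b).

Definition Delta_eigenvalue (w : ratv K) (la : seq nat) : ratv K :=
  \prod_(b <- cells la) (1 - w * toKv q ^+ coarm b * toKv t ^- coleg b).

(* T J_la = e la J_la for all partitions la. *)
Definition is_eigenop (R : comNzRingType) (J : seq nat -> symfun R)
    (e : seq nat -> R) (T : symfun R -> symfun R) : Prop :=
  forall la, is_part la -> T (J la) = e la *: J la.

Definition is_nabla (P : seq nat -> symfun K)
    (T : {linear symfun K -> symfun K}) : Prop :=
  is_eigenop (macdonaldJ P) nabla_eigenvalue T.

(* Delta_w, acting on symmetric functions over K(v). *)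
Definition is_Delta (P : seq nat -> symfun K) (w : ratv K)
    (T : {linear symfun (ratv K) -> symfun (ratv K)}) : Prop :=
  is_eigenop (fun la => map_symfun toKv (macdonaldJ P la))
             (Delta_eigenvalue w) T.

(** * The operators Gamma *)

(* h_n[ZX] for Z = u v (1-t)/(1-q) *)
Definition hsym_Z : nat -> {poly symfun (ratv K)} :=
  hsym_u (fun k => vv ^+ k * (1 - toKv t ^+ k) / (1 - toKv q ^+ k)).

Lemma hsym_Z_low n m : (m < n)%N -> (hsym_Z n)`_m = 0.
Proof.
move=> mn; rewrite /hsym_Z; set c := (X in hsym_u X).
have [g ->] := hsym_u_monomial c n.
by rewrite coefCM coefXn ltn_eqF // mulr0.
Qed.

(* Exp[ZX] = \sum_(n >= 0) h_n[ZX]; the terms n > m do not contribute to the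
   coefficient of u^m (see hsym_Z_low). *)
Definition Exp_Z : useries (symfun (ratv K)) :=
  fun m => \sum_(n < m.+1) (hsym_Z n)`_m.

(* Gamma(u,v), where D and DV are Delta_{1/v} and its inverse. *)
Definition Gamma (D DV : symfun (ratv K) -> symfun (ratv K)) (s : useries (symfun (ratv K))) :
    useries (symfun (ratv K)) :=
  series_map D (series_mul Exp_Z (series_map DV s)).

(* Gamma(u,a), on series with coefficients in Lambda.  The value at v = a is
   taken after composing the three factors, since Delta_{1/v}^-1 alone has
   poles at v = q^m. *)
Definition Gamma_at (D DV : symfun (ratv K) -> symfun (ratv K)) (a : K)
    (s : useries (symfun K)) : useries (symfun K) :=
  series_map (map_symfun (frac_eval a)) (Gamma D DV (series_map (map_symfun toKv) s)).

(* [u^m] nabla^-1 Gamma(u, q^m) nabla, with N, NV for nabla and nabla^-1 *)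
Definition Gamma_plus (N NV : symfun K -> symfun K)
    (D DV : symfun (ratv K) -> symfun (ratv K)) (m : nat) (f : symfun K) : symfun K :=
  series_map NV (Gamma_at D DV (q ^+ m) (series_map N (series_const f))) m.

End Macdonald.

(* Main.v *)
Require Import Defs.
From HB Require Import structures.
From mathcomp Require Import all_boot all_order all_algebra.
From mathcomp Require Import finmap.
From mathcomp Require Import -(notations) monalg.
From mathcomp Require Import mpoly.
From mathcomp Require Import ring zify.

Set Implicit Arguments.
Unset Strict Implicit.
Unset Printing Implicit Defensive.

Import GRing.Theory.
Local Open Scope ring_scope.

(** The scalar product pairs the products of the g_n = h_n[X(1-t)/(1-q)] with
the monomial functions, and those of the n_j = (-1)^j e_j with the
coefficients of f[-Z(1-q)/(1-t)].  In generating series,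
  G(qu) Exp[-tuX] = Exp[uX(q-t)/(1-q)] = G(u) Exp[-uX],
so that every symmetric function satisfies F(qy, tz) = F(y, z) at y = z, where
F(y, z) = f[X + y - z(1-q)/(1-t)].  For f = P_la, the degrees of F in the y's
are bounded by the dominance order and those in the z's by the conjugate order.
Under these bounds the functional equation forces the top coefficient in y to
be P_(la_2, la_3, ...), and it gives the ratio of the corresponding norms one
column of la at a time.  This determines the part of g_m P_mu without a row
longer than m: it is a multiple of P_(m, mu).  The constituents P_ka with a
longer row disappear from Gamma(u, v) at v = q^m, because the box in the first
row of content q^m contributes the factor v - q^m; the other factors reduce the
remaining multiple to J_(m, mu). *)

(** * Newton's identities *)

(** The full Pieri rule for g_m P_mu is never established: constituents with a row longer than m die
    at v = q^m, so a single coefficient matters, that of P_(m, mu). The obstacle is a circularity.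
    Recognizing the top coefficient in y as P_mu requires the extreme coefficients [cnorm nu] (of
    P_nu at z^{nu'}) to be nonzero in degree |mu|, while the nonvanishing of [cnorm] at (m, mu)
    comes from that very identification; hence the induction on the degree in [cnorm_neq0]. The
    constants match column by column. In column j, counted from 0 and of length l in mu, the new
    cell of (m, mu) has content c = q^j t^(-l) and contributes q^m - c = -c (1 - q^(m-j) t^l) to the
    ratio of Delta eigenvalues. The last factor cancels the denominator of the Pieri coefficient;
    the numerator 1 - q^(m-j-1) t^(l+1) is the hook factor of the first row in J_(m, mu); the
    factors -c form the ratio of the eigenvalues of nabla. Since mu_1 <= m, no content of mu equals
    q^m, so the evaluation at v = q^m meets no pole. *)

Section Newton.
Variables (K : fieldType) (A : comAlgType K) (ps : nat -> A).

(* h_n[wX] for the alphabet with p_k[wX] = w_k p_k, by Newton's identities. *)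
Fixpoint hlist (w : nat -> K) (n : nat) : seq A :=
  if n is n'.+1 then
    (n%:R^-1 *: \sum_(i < n) w i.+1 *: (ps i.+1 * (hlist w n')`_i)) :: hlist w n'
  else [:: 1].

Definition hpleth (w : nat -> K) (n : nat) : A := (hlist w n)`_0.

Lemma nth_hlist w n i : (i <= n)%N -> (hlist w n)`_i = hpleth w (n - i).
Proof. by elim: n i => [|n IH] [|i] //= le; rewrite IH // subSS. Qed.

Hypothesis char0 : forall k, k.+1%:R != 0 :> K.

Lemma hpleth0 w : hpleth w 0 = 1. Proof. by []. Qed.

Lemma hplethS w n :
  n.+1%:R *: hpleth w n.+1 =
  \sum_(i < n.+1) w i.+1 *: (ps i.+1 * hpleth w (n - i)).
Proof.
rewrite {1}/hpleth [hlist w n.+1]/= [nth _ _ _]/= scalerA divff // scale1r.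
by apply: eq_bigr => i _; rewrite nth_hlist ?leq_ord.
Qed.

(** Each n+1 is invertible, so the recursion determines the sequence; identities between series are
    proved below by checking the recursion. *)
Lemma hpleth_uniq (w : nat -> K) (a : nat -> A) :
  a 0%N = 1 ->
  (forall n, n.+1%:R *: a n.+1 = \sum_(i < n.+1) w i.+1 *: (ps i.+1 * a (n - i)%N)) ->
  forall n, a n = hpleth w n.
Proof.
move=> a0 aS n; elim/ltn_ind: n => -[_|n IH]; first by rewrite a0 hpleth0.
apply: (@scalerI _ _ n.+1%:R) => //; rewrite aS hplethS.
by apply: eq_bigr => i _; rewrite IH // ltnS leq_subr.
Qed.

Lemma sum_triangle (V : zmodType) (F : nat -> nat -> V) n :
  \sum_(i < n) \sum_(k < i.+1) F k (i - k)%N =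
  \sum_(k < n) \sum_(j < n - k) F k j.
Proof.
elim: n => [|n IH]; first by rewrite !big_ord0.
rewrite big_ord_recr /= IH.
under [RHS]eq_bigr => k _ do rewrite subSn ?leq_ord // big_ord_recr /=.
rewrite big_split /=; congr (_ + _).
by rewrite big_ord_recr /= subnn big_ord0 addr0.
Qed.

Definition hconv (w w' : nat -> K) n : A :=
  \sum_(i < n.+1) hpleth w i * hpleth w' (n - i).

Lemma hconvC w w' n : hconv w w' n = hconv w' w n.
Proof.
rewrite /hconv (reindex_inj rev_ord_inj) /=; apply: eq_bigr => i _.
by rewrite subSS subKn ?leq_ord // mulrC.
Qed.

(** Newton's recursion says that u d/du acts on the series of [hpleth w] as multiplication by the
    sum of the w_k p_k u^k. Weighting by the degree of the first factor only therefore multiplies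
    the whole product by this series. *)
Lemma hconv_half w w' n :
  \sum_(i < n.+2) i%:R *: (hpleth w i * hpleth w' (n.+1 - i)) =
  \sum_(i < n.+1) w i.+1 *: (ps i.+1 * hconv w w' (n - i)).
Proof.
rewrite big_ord_recl scale0r add0r.
pose F k j := w k.+1 *: (ps k.+1 * (hpleth w j * hpleth w' (n - k - j))).
transitivity (\sum_(i < n.+1) \sum_(k < i.+1) F k (i - k)%N).
  apply: eq_bigr => i _; rewrite /= /bump /= add1n subSS scalerAl hplethS.
  rewrite mulr_suml; apply: eq_bigr => k _.
  by rewrite /F -scalerAl -mulrA -subnDA subnKC // -ltnS.
rewrite sum_triangle; apply: eq_bigr => k _.
by rewrite subSn ?leq_ord // /hconv mulr_sumr scaler_sumr.
Qed.

(** Logarithmic derivatives add: n+1 = i + (n+1-i) splits the recursion into two halves, each given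
    by [hconv_half]. *)
Lemma hpleth_mul w w' n :
  \sum_(i < n.+1) hpleth w i * hpleth w' (n - i) =
  hpleth (fun k => w k + w' k) n.
Proof.
move: n; apply: hpleth_uniq => [|n]; first by rewrite big_ord1 mulr1.
transitivity (\sum_(i < n.+2) i%:R *: (hpleth w i * hpleth w' (n.+1 - i)) +
              \sum_(i < n.+2) i%:R *: (hpleth w' i * hpleth w (n.+1 - i))).
  rewrite [X in _ + X](reindex_inj rev_ord_inj) /= -big_split scaler_sumr /=.
  apply: eq_bigr => i _.
  rewrite subSS subKn ?leq_ord // [hpleth w' _ * _]mulrC -scalerDl -natrD.
  by rewrite subnKC // leq_ord.
rewrite !hconv_half -big_split; apply: eq_bigr => i _ /=.
by rewrite (hconvC w') -scalerDl.
Qed.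

Lemma hpleth_scale (a : K) w n :
  hpleth (fun k => a ^+ k * w k) n = a ^+ n *: hpleth w n.
Proof.
symmetry; move: n; apply: hpleth_uniq => [|n]; first by rewrite scale1r.
rewrite scalerA mulrC -scalerA hplethS scaler_sumr; apply: eq_bigr => i _.
rewrite -scalerAr !scalerA mulrAC; congr ((_ * _) *: _).
by rewrite -exprD addSn subnKC // -ltnS.
Qed.

Lemma eq_hpleth (w w' : nat -> K) : (forall k, w k.+1 = w' k.+1) -> hpleth w =1 hpleth w'.
Proof.
move=> E; apply: hpleth_uniq => // n; rewrite hplethS.
by apply: eq_bigr => i _; rewrite E.
Qed.

(* With G(u) = Exp[uX(1-t)/(1-q)], both G(qu) Exp[-tuX] and G(u) Exp[-uX] are
   Exp[uX(q-t)/(1-q)]. *)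
Lemma hpleth_quasi_inv (q t : K) w n :
  (forall k, w k.+1 * (1 - q ^+ k.+1) = 1 - t ^+ k.+1) ->
  \sum_(i < n.+1) (1 - q ^+ i * t ^+ (n - i)) *:
     (hpleth w i * hpleth (fun=> - 1) (n - i)) = 0.
Proof.
move=> hw; under eq_bigr do rewrite scalerBl scale1r.
rewrite sumrB hpleth_mul.
under [X in _ - X]eq_bigr => i _.
  rewrite -scalerA scalerAr [_ *: (_ * _)]scalerAl -!hpleth_scale.
  over.
rewrite /= hpleth_mul; apply/eqP; rewrite subr_eq0; apply/eqP/eq_hpleth => k.
apply/eqP; rewrite -subr_eq0; apply/eqP.
transitivity (w k.+1 * (1 - q ^+ k.+1) - (1 - t ^+ k.+1)); first by ring.
by rewrite hw subrr.
Qed.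

End Newton.

(** * The scalar product *)

(* The polynomial ring in the power sums, with its monomial basis [mn] and
   dual coefficients [pc], as an abstract structure: this keeps its operations
   from being unfolded in the computations below. *)
Record symalg (K : fieldType) := Symalg {
  car :> comAlgType K;
  ps : nat -> car;
  ev : forall S : comNzRingType, {rmorphism K -> S} -> (nat -> S) ->
         {rmorphism car -> S};
  mn : cmonom nat -> car;
  pc : cmonom nat -> car -> K;
  cf : (cmonom nat -> K) -> car -> K;
  evZ : forall S iota phi x f, @ev S iota phi (x *: f) = iota x * @ev S iota phi f;
  ev_ps : forall S iota phi k, (0 < k)%N -> @ev S iota phi (ps k) = phi k;
  mn1 : mn one = 1;
  mnM : forall k m, mn (mul (ucm k) m) = ps k.+1 * mn m;
  pcD : forall m f g, pc m (f + g) = pc m f + pc m g;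
  pcZ : forall m x f, pc m (x *: f) = x * pc m f;
  pc_mn : forall m m', pc m (mn m') = (m' == m)%:R;
  cf0 : forall F, cf F 0 = 0;
  cfD : forall F f g, cf F (f + g) = cf F f + cf F g;
  cf_mn : forall F x m, cf F (x *: mn m) = x * F m;
  mn_sum : forall f, exists r : seq (cmonom nat),
    f = \sum_(m <- r) pc m f *: mn m;
  pcP : forall f, (forall m, pc m f = 0) -> f = 0
}.

Section SymalgTheory.
Variables (K : fieldType) (A : symalg K).
Implicit Types (f g h : A) (m : cmonom nat) (k : nat).
Local Notation p := (ps A).
Local Notation mn := (@mn K A).
Local Notation pc := (@pc K A).

Lemma pc0 m : pc m 0 = 0.
Proof. by rewrite -(scale0r 0) pcZ mul0r. Qed.

Lemma pc1 m : pc m 1 = (m == one)%:R.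
Proof. by rewrite -mn1 pc_mn eq_sym. Qed.

Lemma pc_sum I (r : seq I) (Q : pred I) (F : I -> A) m :
  pc m (\sum_(i <- r | Q i) F i) = \sum_(i <- r | Q i) pc m (F i).
Proof.
elim/big_rec2: _ => [|i y z _ <-]; first exact: pc0.
by rewrite pcD.
Qed.

Lemma mul_ucmK k m : m k != 0%N -> m = mul (ucm k) (divcm m (ucm k)).
Proof.
move=> mk; apply/eqP/cmP => j; rewrite cmM divcmE ucmE.
case: (k =P j) => [<-|] /=; last by rewrite subn0.
by rewrite subnKC // lt0n.
Qed.

Lemma cmonom_ind (Pr : cmonom nat -> Prop) :
  Pr one -> (forall i m, Pr m -> Pr (mul (ucm i) m)) -> forall m, Pr m.
Proof.
move=> P1 PM m; move: {2}(monalg.mdeg m) (erefl (monalg.mdeg m)) => n.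
elim: n m => [|n IH] m dm; first by rewrite (mdeg_eq0I dm).
have [i mi] : exists i, m i != 0%N.
  have : finsupp m != fset0.
    by apply: contra_eq_neq dm => m0; rewrite monalg.mdegE m0 big_seq_fset0.
  by case/fset0Pn => i; rewrite -cmE_neq0; exists i.
rewrite (mul_ucmK mi); apply/PM/IH; apply/eqP; rewrite -eqSS -dm.
by rewrite {2}(mul_ucmK mi) monalg.mdegM monalg.mdegU.
Qed.

Lemma symalg_ind (Pr : A -> Prop) :
  Pr 0 -> (forall f g, Pr f -> Pr g -> Pr (f + g)) ->
  (forall (x : K) f, Pr f -> Pr (x *: f)) ->
  Pr 1 -> (forall k f, Pr f -> Pr (p k.+1 * f)) -> forall f, Pr f.
Proof.
move=> P0 PD PZ P1 PM f; have [r ->] := mn_sum f.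
elim/big_ind: _ => // m _; apply: PZ.
elim/cmonom_ind: m => [|i m IH]; first by rewrite mn1.
by rewrite mnM; apply: PM.
Qed.

Lemma pc_psM k f m : pc (mul (ucm k) m) (p k.+1 * f) = pc m f.
Proof.
have [r ->] := mn_sum f.
rewrite mulr_sumr !pc_sum; apply: eq_bigr => m' _.
rewrite -scalerAr -mnM !pcZ !pc_mn; congr (_ * (_ : bool)%:R).
apply/eqP/eqP => [E|-> //]; apply/eqP/cmP => i.
by move/eqP/cmP/(_ i): E; rewrite !cmM => /addnI.
Qed.

Lemma pc_psM0 k f m : m k = 0%N -> pc m (p k.+1 * f) = 0.
Proof.
move=> mk; have [r ->] := mn_sum f.
rewrite mulr_sumr pc_sum; apply: big1 => m' _.
rewrite -scalerAr -mnM pcZ pc_mn.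
by case: eqP => [E|]; [move: mk; rewrite -E cmM cmUU | rewrite mulr0].
Qed.

(** * The (q,t)-form and the adjoints of multiplication by power sums *)

Section Form.
Variable q t : K.

Definition qt_ratio k : K := (1 - q ^+ k) / (1 - t ^+ k).
Local Notation c := qt_ratio.

(** The norm of the power-sum monomial of exponent m; these monomials are pairwise orthogonal. *)
Definition qt_weight m : K := zmon K m * pleth_mon c m.
Local Notation W := qt_weight.

Definition qt_form f g : K := cf (fun m => W m * pc m g) f.
Local Notation B := qt_form.

Lemma pleth_mon_ucmM m k :
  pleth_mon c (mul (ucm k) m) = c k.+1 * pleth_mon c m.
Proof.
rewrite mmorphM; congr (_ * _).
by rewrite /= /pleth_mon mdomU big_seq_fset1 cmUU expr1.
Qed.

(** The substitution p_k -> c_k p_k is diagonal on monomials; this ties [qt_form] to the plethystic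
    definition in [qt_form_hall]. *)
Lemma pc_scaled g m :
  pc m (ev A (in_alg A) (fun k => c k *: p k) g) = pleth_mon c m * pc m g.
Proof.
elim/symalg_ind: g m => [|f g IHf IHg|x f IH||k f IH] m.
- by rewrite rmorph0 pc0 mulr0.
- by rewrite rmorphD !pcD IHf IHg mulrDr.
- by rewrite evZ /= -scalerAl mul1r !pcZ IH mulrCA.
- rewrite rmorph1 pc1; case: eqP => [->|_]; last by rewrite mulr0.
  by rewrite mmorph1 mulr1.
rewrite rmorphM /= ev_ps // -scalerAl pcZ.
have [mk|mk] := eqVneq (m k) 0%N; first by rewrite !pc_psM0 // !mulr0.
rewrite (mul_ucmK mk); move: (divcm m (ucm k)) => {mk}m.
by rewrite !pc_psM IH pleth_mon_ucmM mulrA.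
Qed.

Lemma form0l g : B 0 g = 0. Proof. exact: cf0. Qed.

Lemma formDl f f' g : B (f + f') g = B f g + B f' g.
Proof. exact: cfD. Qed.

Lemma form_mnZ (x : K) m g : B (x *: mn m) g = x * (W m * pc m g).
Proof. exact: cf_mn. Qed.

Lemma form1l g : B 1 g = pc one g.
Proof.
rewrite -mn1 -[mn one]scale1r form_mnZ mul1r /W mmorph1 /zmon mdom1.
by rewrite big_seq_fset0 !mul1r.
Qed.

Lemma form_suml I (r : seq I) (Q : pred I) (F : I -> A) g :
  B (\sum_(i <- r | Q i) F i) g = \sum_(i <- r | Q i) B (F i) g.
Proof.
elim/big_rec2: _ => [|i y z _ <-]; first exact: form0l.
by rewrite formDl.
Qed.

Lemma formZl (x : K) f g : B (x *: f) g = x * B f g.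
Proof.
have [r ->] := mn_sum f; rewrite scaler_sumr !form_suml mulr_sumr.
by apply: eq_bigr => m _; rewrite scalerA !form_mnZ -mulrA.
Qed.

Lemma formC f g : B f g = B g f.
Proof.
have [r ->] := mn_sum f; have [s ->] := mn_sum g.
rewrite !form_suml.
under eq_bigr => m _ do rewrite form_mnZ pc_sum !mulr_sumr.
under [RHS]eq_bigr => m _ do rewrite form_mnZ pc_sum !mulr_sumr.
rewrite [RHS]exchange_big /=; apply: eq_bigr => m _.
apply: eq_bigr => m' _; rewrite !pcZ !pc_mn eq_sym.
by case: eqP => [->|_] /=; ring.
Qed.

Lemma form0r f : B f 0 = 0.
Proof. by rewrite formC form0l. Qed.

Lemma formDr f g g' : B f (g + g') = B f g + B f g'.
Proof. by rewrite !(formC f) formDl. Qed.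

Lemma formZr (x : K) f g : B f (x *: g) = x * B f g.
Proof. by rewrite !(formC f) formZl. Qed.

Lemma form_sumr I (r : seq I) (Q : pred I) (F : I -> A) f :
  B f (\sum_(i <- r | Q i) F i) = \sum_(i <- r | Q i) B f (F i).
Proof.
by rewrite formC form_suml; apply: eq_bigr => i _; rewrite formC.
Qed.

(* The derivation (k c_k) d/dp_k, read off from p_k |-> p_k + k c_k 'X; it is
   adjoint to the multiplication by p_k. *)
Definition ps_shift k : {rmorphism A -> {poly A}} :=
  ev A (polyC \o in_alg A)
    (fun j => (p j)%:P + ((j == k)%:R * (k%:R * c k))%:A%:P * 'X).

Definition ps_adj k f : A := (ps_shift k f)`_1.
Local Notation D := ps_adj.

Lemma ps_shift_coef0 k f : (ps_shift k f)`_0 = f.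
Proof.
rewrite /ps_shift; elim/symalg_ind: f => [|f g IHf IHg|x f IH||j f IH].
- by rewrite rmorph0 coef0.
- by rewrite rmorphD coefD IHf IHg.
- by rewrite evZ /= coefCM IH -scalerAl mul1r.
- by rewrite rmorph1 coef1.
by rewrite rmorphM /= coef0M IH ev_ps // coefD coefC coefMX /= addr0.
Qed.

Lemma ps_adj0 k : D k 0 = 0.
Proof. by rewrite /D rmorph0 coef0. Qed.

Lemma ps_adjD k f g : D k (f + g) = D k f + D k g.
Proof. by rewrite /D rmorphD coefD. Qed.

Lemma ps_adj_sum k I (r : seq I) (Q : pred I) (F : I -> A) :
  D k (\sum_(i <- r | Q i) F i) = \sum_(i <- r | Q i) D k (F i).
Proof. by rewrite /D rmorph_sum coef_sum. Qed.

Lemma ps_adjZ k (x : K) f : D k (x *: f) = x *: D k f.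
Proof. by rewrite /D /ps_shift evZ /= coefCM -scalerAl mul1r. Qed.

Lemma ps_adj1 k : D k 1 = 0.
Proof. by rewrite /D rmorph1 coef1. Qed.

Lemma ps_adjM k f g : D k (f * g) = D k f * g + f * D k g.
Proof.
rewrite /D rmorphM coefM big_ord_recl big_ord1 /=.
by rewrite !ps_shift_coef0 addrC.
Qed.

Lemma ps_adj_ps k j : (0 < j)%N ->
  D k (p j) = ((j == k)%:R * (k%:R * c k))%:A.
Proof.
move=> j0; rewrite /D /ps_shift ev_ps // coefD coefC coefMX coefC /=.
by rewrite add0r.
Qed.

Lemma ps_adj_prod k (I : eqType) (r : seq I) (F : I -> A) : uniq r ->
  D k (\prod_(i <- r) F i) =
  \sum_(i <- r) D k (F i) * \prod_(j <- r | j != i) F j.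
Proof.
elim: r => [|i r IH] /=; first by rewrite !big_nil ps_adj1.
case/andP=> ir ur; rewrite big_cons ps_adjM IH // [RHS]big_cons; congr (_ + _).
  rewrite big_cons eqxx /=; congr (_ * _); rewrite big_seq [RHS]big_seq_cond.
  apply: eq_bigl => j; case jr: (j \in r) => //=; apply/esym.
  by apply: contraNneq ir => <-.
rewrite mulr_sumr !big_seq; apply: eq_bigr => j jr.
rewrite big_cons (_ : i != j); first by rewrite mulrCA.
by apply: contraNneq ir => ->.
Qed.

(** The factor is the one by which the norm changes in [qt_weightM]; their agreement is the
    adjointness [ps_adjP]. *)
Lemma pc_ps_adj k f m :
  pc m (D k.+1 f) =
  (m k).+1%:R * (k.+1%:R * c k.+1) * pc (mul (ucm k) m) f.
Proof.
elim/symalg_ind: f m => [|f g IHf IHg|x f IH||j f IH] m.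
- by rewrite ps_adj0 !pc0 mulr0.
- by rewrite ps_adjD !pcD IHf IHg mulrDr.
- by rewrite ps_adjZ !pcZ IH mulrCA.
- rewrite ps_adj1 pc0 pc1; case: eqP => [/eqP/cmP/(_ k)|_].
    by rewrite cmM cmUU cm1.
  by rewrite mulr0.
rewrite ps_adjM ps_adj_ps // pcD -!scalerAl mul1r !pcZ eqSS.
have [->|jk] := eqVneq j k.
  rewrite mul1r pc_psM.
  have [mk|mk] := eqVneq (m k) 0%N; first by rewrite pc_psM0 // mk; ring.
  rewrite (mul_ucmK mk); move: (divcm m (ucm k)) => {mk}m.
  by rewrite pc_psM IH cmM cmUU add1n -[(m k).+2%:R]natr1; ring.
rewrite !mul0r add0r; have [mj|mj] := eqVneq (m j) 0%N.
  by rewrite !pc_psM0 ?mulr0 // cmM mj addn0 ucmE eq_sym (negbTE jk).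
rewrite (mul_ucmK mj); move: (divcm m (ucm j)) => {mj}m.
rewrite (mulmA (ucm k)) (mulmC (ucm k)) -mulmA !pc_psM IH cmM ucmE.
by rewrite (negbTE jk).
Qed.

Lemma qt_weightM k m :
  W (mul (ucm k) m) = (m k).+1%:R * (k.+1%:R * c k.+1) * W m.
Proof.
rewrite /W pleth_mon_ucmM /zmon.
have sub : fsubset (finsupp m) (finsupp (mul (ucm k) m)).
  by rewrite mdomD fsubsetUr.
rewrite [X in _ = _ * (X * _)](big_fset_incl _ sub) /=; last first.
  by move=> i _; rewrite -cmE_neq0 negbK => /eqP ->; rewrite expn0.
have kin : k \in finsupp (mul (ucm k) m) by rewrite -cmE_neq0 cmM cmUU.
rewrite (big_fsetD1 k kin) [in RHS](big_fsetD1 k kin) /= cmM cmUU add1n factS expnS.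
rewrite (eq_big_seq (fun i => ((m i)`! * i.+1 ^ m i)%:R)) => [|i].
  rewrite !natrM; move: (_ `!)%:R (_ ^ _)%:R (\prod_(_ <- _) _) (pleth_mon _ _) (c _).
  by move=> *; ring.
by rewrite !inE => /andP[ik _]; rewrite cmM ucmE eq_sym (negbTE ik).
Qed.

Lemma ps_adjP k f g : (0 < k)%N -> B (p k * f) g = B f (D k g).
Proof.
case: k => // k _; have [r ->] := mn_sum f; rewrite mulr_sumr !form_suml.
apply: eq_bigr => m _; rewrite -scalerAr -mnM !form_mnZ.
by rewrite pc_ps_adj qt_weightM; ring.
Qed.

Lemma form_nondeg f :
  (forall k, k.+1%:R != 0 :> K) -> (forall k, c k.+1 != 0) ->
  (forall g, B g f = 0) -> f = 0.
Proof.
move=> char0 c0 Bf; apply/pcP => m.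
have := Bf (mn m); rewrite -[mn m]scale1r form_mnZ mul1r.
have : W m != 0.
  elim/cmonom_ind: m => [|i m IH].
    by rewrite /W mmorph1 /zmon mdom1 big_seq_fset0 mulr1 oner_eq0.
  rewrite qt_weightM; apply: mulf_neq0 IH; apply: mulf_neq0 => //.
  by apply: mulf_neq0; [exact: char0 | exact: c0].
by move/mulfI => inj E; apply: inj; rewrite mulr0.
Qed.

Hypothesis char0 : forall k, k.+1%:R != 0 :> K.
Local Notation H := (hpleth p).

(** The logarithm of the generating series is the sum of the w_k p_k u^k / k, so k c_k d/dp_k
    multiplies the series by w_k c_k u^k. *)
Lemma ps_adj_hpleth k w r : (0 < k)%N ->
  D k (H w r) = if (k <= r)%N then (w k * c k) *: H w (r - k) else 0.
Proof.
case: k => // k _; elim/ltn_ind: r => -[_|r IH]; first by rewrite ps_adj1.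
apply: (@scalerI _ _ r.+1%:R) => //.
rewrite -ps_adjZ hplethS // ps_adj_sum.
(* Leibniz on Newton's recursion: the first sum differentiates p_(i+1), the second the other factor,
   known by induction. *)
transitivity (\sum_(i < r.+1)
   (w i.+1 * (i == k :> nat)%:R * (k.+1%:R * c k.+1)) *: H w (r - i) +
   \sum_(i < r.+1) if (i < r.+1 - k.+1)%N then
     (w k.+1 * c k.+1) *: (w i.+1 *: (p i.+1 * H w (r - k.+1 - i))) else 0).
  rewrite -big_split; apply: eq_bigr => i _ /=.
  rewrite ps_adjZ ps_adjM ps_adj_ps // scalerDr -scalerAl mul1r !scalerA eqSS.
  rewrite [w i.+1 * (_ * _)]mulrA; congr (_ + _); rewrite IH ?ltnS ?leq_subr // subSS.
  rewrite -!subnDA [(i + _)%N]addnC.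
  have -> : (k < r - i)%N = (i < r - k)%N by rewrite !ltn_subRL addnC.
  case: ifP => _; last by rewrite mulr0 scaler0.
  by rewrite -scalerAr !scalerA mulrC.
rewrite subSS ltnS; case: leqP => kr; last first.
  rewrite !big1 ?addr0 ?scaler0 // => i _.
    by rewrite (_ : (r - k)%N = 0%N) //; apply/eqP; rewrite subn_eq0 ltnW.
  case: eqP => [E|_]; last by rewrite mulr0 mul0r scale0r.
  by move: (ltn_ord i); rewrite E ltnS leqNgt kr.
rewrite (bigD1 (inord k)) //= inordK // eqxx [X in _ + X + _]big1 ?addr0; last first.
  move=> i ik; case: eqP => [E|_]; last by rewrite mulr0 mul0r scale0r.
  by case/eqP: ik; apply: val_inj; rewrite /= inordK // E.
rewrite -big_mkcond /=.
have le : (r - k <= r.+1)%N by rewrite (leq_trans (leq_subr _ _)).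
rewrite (big_ord_narrow le) /= -scaler_sumr.
case: (ltnP k r) => [kr'|rk].
  have -> : (r - k = (r - k.+1).+1)%N by rewrite -subSn.
  rewrite -hplethS // !scalerA -scalerDl; congr (_ *: _).
  have -> : r.+1%:R = (r - k.+1).+1%:R + k.+1%:R :> K.
    by rewrite -natrD addSn subnK.
  by ring.
have -> : r = k by apply/eqP; rewrite eqn_leq kr rk.
rewrite subnn big_ord0 scaler0 addr0 !scalerA; congr (_ *: _); ring.
Qed.

(* The reproducing property of the Cauchy kernel. *)
Lemma form_hpleth_prod n (w : 'I_n -> nat -> K) (a : 'X_{1..n}) f :
  B (\prod_(i < n) H (w i) (a i)) f =
  (ev A (@mpolyC n K)
     (fun k => \sum_(i < n) (w i k * c k) *: 'X_i ^+ k) f)@_a.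
Proof.
elim/symalg_ind: f a => [|f g IHf IHg|x f IH||k f IH] a.
- by rewrite form0r rmorph0 mcoeff0.
- by rewrite formDr rmorphD mcoeffD IHf IHg.
- by rewrite formZr evZ mul_mpolyC mcoeffZ IH.
- rewrite rmorph1 mcoeff1 formC form1l.
  (* [e0] kills every p_k, so it computes the constant coefficient, which is the pairing with 1. *)
  pose e0 := ev A idfun (fun=> 0 : K).
  have pce f : pc one f = e0 f.
    elim/symalg_ind: f => [|g g' IHg IHg'|x g IH||j g IH].
    - by rewrite pc0 rmorph0.
    - by rewrite pcD rmorphD IHg IHg'.
    - by rewrite pcZ evZ IH.
    - by rewrite pc1 eqxx rmorph1.
    by rewrite pc_psM0 ?cm1 // rmorphM /= ev_ps // mul0r.
  rewrite pce.
  have e0H v r : e0 (H v r) = (r == 0%N)%:R.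
    case: r => [|r]; first by rewrite rmorph1.
    apply: (mulfI (char0 r)).
    have <- : e0 (r.+1%:R *: H v r.+1) = r.+1%:R * e0 (H v r.+1) by exact: evZ.
    rewrite hplethS // mulr0 rmorph_sum big1 // => j _.
    by rewrite evZ rmorphM /= ev_ps // mul0r mulr0.
  rewrite rmorph_prod.
  under eq_bigr do rewrite e0H.
  have [->|an] := eqVneq a 0%MM.
    by rewrite big1 // => i _; rewrite mnm0E.
  have [i ai] : exists i, a i != 0%N.
    apply/existsP; apply: contraNT an; rewrite negb_exists => /forallP E.
    by apply/eqP/mnmP => i; rewrite mnm0E; apply/eqP; have := E i; rewrite negbK.
  by rewrite (bigD1 i) //= (negbTE ai) mul0r.
rewrite formC ps_adjP // formC ps_adj_prod ?index_enum_uniq // form_suml.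
rewrite rmorphM /= ev_ps // mulr_suml raddf_sum /=; apply: eq_bigr => i _.
rewrite ps_adj_hpleth // -scalerAl mcoeffZ mcoeff_mulX.
case: ifP => ka; last by rewrite mul0r form0l mulr0.
rewrite -scalerAl formZl -IH; congr (_ * B _ _).
rewrite [RHS](bigD1 i) //= mnmBE mulmnE mnmE eqxx mul1n; congr (_ * _).
apply: eq_bigr => j ji; rewrite mnmBE mulmnE mnmE eq_sym (negbTE ji) mul0n.
by rewrite subn0.
Qed.

End Form.
End SymalgTheory.

(** * Reproducing kernels *)

Section Kernels.
Variables (K : fieldType) (A : symalg K) (q t : K).
Hypothesis char0 : forall k, k.+1%:R != 0 :> K.
Hypothesis qt_generic : forall i j, (0 < i + j)%N -> 1 - q ^+ i * t ^+ j != 0.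
Implicit Types (f h : A) (al be : seq nat).

Local Notation p := (ps A).
Local Notation c := (qt_ratio q t).
Local Notation B := (qt_form q t).

Lemma qt_ratio_neq0 k : c k.+1 != 0.
Proof.
apply: mulf_neq0; last rewrite invr_eq0.
  by have := @qt_generic k.+1 0 isT; rewrite mulr1.
by have := @qt_generic 0 k.+1 isT; rewrite mul1r.
Qed.

(* g_n = h_n[X(1-t)/(1-q)] *)
Definition gsym : nat -> A := hpleth p (fun k => (c k)^-1).
(* (-1)^n e_n *)
Definition nesym : nat -> A := hpleth p (fun=> - 1).
Local Notation g := gsym.
Local Notation E := nesym.

Definition gprod al : A := \prod_(a <- al) g a.
Definition eprod be : A := \prod_(b <- be) E b.

Lemma gsym_nesym N :
  \sum_(i < N.+1) (1 - q ^+ i * t ^+ (N - i)) *: (g i * E (N - i)) = 0.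
Proof.
apply: hpleth_quasi_inv => // k.
have q1 : 1 - q ^+ k.+1 != 0 by have := @qt_generic k.+1 0 isT; rewrite mulr1.
by rewrite /qt_ratio invfM invrK mulrC mulrA mulfV // mul1r.
Qed.

(** Only the products w_k phi_k enter Newton's recursion, so weights can be moved between the
    alphabet and the specialization. In [dualvars_g] the weights 1/c_k and -c_k combine into -1. *)
Lemma ev_hpleth_ext (S : comNzRingType) (iota : {rmorphism K -> S}) phi phi' w w' n :
  (forall k, iota (w k.+1) * phi k.+1 = iota (w' k.+1) * phi' k.+1) ->
  ev A iota phi (hpleth p w n) = ev A iota phi' (hpleth p w' n).
Proof.
move=> eq_phi; elim/ltn_ind: n => -[_|n IH]; first by rewrite !rmorph1.
have inv (x y : S) : iota n.+1%:R * x = iota n.+1%:R * y -> x = y.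
  move/(congr1 ( *%R (iota n.+1%:R^-1))).
  by rewrite !mulrA -!rmorphM mulVf // !rmorph1 !mul1r.
apply: inv; rewrite -!evZ !hplethS // !rmorph_sum; apply: eq_bigr => i _ /=.
by rewrite !evZ !rmorphM /= !ev_ps // !mulrA eq_phi IH // ltnS leq_subr.
Qed.

Definition invars n : {rmorphism A -> {mpoly K[n]}} :=
  ev A (@mpolyC n K) (fun k => \sum_(i < n) 'X_i ^+ k).

(* The super-specialization f[-(1-q)/(1-t) Z] in the variables Z. *)
Definition dualvars n : {rmorphism A -> {mpoly K[n]}} :=
  ev A (@mpolyC n K) (fun k => \sum_(i < n) (- c k) *: 'X_i ^+ k).

Lemma invarsZ n x f : invars n (x *: f) = x *: invars n f.
Proof. by rewrite /invars evZ mul_mpolyC. Qed.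

Lemma form_gprodE n (a : 'X_{1..n}) f :
  B (\prod_(i < n) g (a i)) f = (invars n f)@_a.
Proof.
rewrite form_hpleth_prod //; congr (_@__); rewrite /invars.
elim/symalg_ind: f => [|f h IHf IHh|x f IH||k f IH].
- by rewrite !rmorph0.
- by rewrite !rmorphD IHf IHh.
- by rewrite !evZ IH.
- by rewrite !rmorph1.
rewrite !rmorphM IH /= !ev_ps //; congr (_ * _); apply: eq_bigr => i _.
by rewrite mulVf ?qt_ratio_neq0 // scale1r.
Qed.

Lemma form_eprodE n (b : 'X_{1..n}) f :
  B (\prod_(i < n) E (b i)) f = (dualvars n f)@_b.
Proof.
rewrite form_hpleth_prod //; congr (_@__); rewrite /dualvars.
elim/symalg_ind: f => [|f h IHf IHh|x f IH||k f IH].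
- by rewrite !rmorph0.
- by rewrite !rmorphD IHf IHh.
- by rewrite !evZ IH.
- by rewrite !rmorph1.
rewrite !rmorphM IH /= !ev_ps //; congr (_ * _); apply: eq_bigr => i _.
by rewrite mulN1r.
Qed.

Lemma dualvars_g n r : dualvars n (g r) = invars n (E r).
Proof.
apply: ev_hpleth_ext => k; rewrite !mulr_sumr; apply: eq_bigr => i _.
rewrite !mul_mpolyC scalerA mulrN mulVf ?qt_ratio_neq0 //.
Qed.

Definition seqmn al : 'X_{1..size al} := [multinom nth 0%N al i | i < size al].

Lemma gprod_ord al : gprod al = \prod_(i < size al) g (seqmn al i).
Proof.
rewrite /gprod (big_nth 0%N) big_mkord; apply: eq_bigr => i _.
by rewrite mnmE.
Qed.

Lemma eprod_ord be : eprod be = \prod_(i < size be) E (seqmn be i).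
Proof.
rewrite /eprod (big_nth 0%N) big_mkord; apply: eq_bigr => i _.
by rewrite mnmE.
Qed.

Lemma form_gprod al f : B (gprod al) f = (invars (size al) f)@_(seqmn al).
Proof. by rewrite gprod_ord form_gprodE. Qed.

Lemma form_eprod be f : B (eprod be) f = (dualvars (size be) f)@_(seqmn be).
Proof. by rewrite eprod_ord form_eprodE. Qed.

Lemma dualvars1_g r :
  dualvars 1 (g r) = if (r <= 1)%N then (- 'X_ord0) ^+ r else 0.
Proof.
rewrite dualvars_g /invars.
elim/ltn_ind: r => -[_|r IH]; first by rewrite rmorph1.
have inv (x y : {mpoly K[1]}) : r.+1%:R%:MP * x = r.+1%:R%:MP * y -> x = y.
  move/(congr1 ( *%R r.+1%:R^-1%:MP)).
  by rewrite !mulrA -!mpolyCM mulVf // !mul1r.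
apply: inv; rewrite -evZ hplethS // rmorph_sum.
under eq_bigr => i _.
  rewrite evZ rmorphM /= ev_ps // big_ord1 IH ?ltnS ?leq_subr // mpolyCN.
  rewrite mulN1r.
  over.
case: r {IH} => [|r]; first by rewrite big_ord1 /= mulr1 !expr1 mul1r.
(* From degree 2 on, all but the last two terms of the recursion vanish by induction, and these two
   cancel. *)
rewrite big_ord_recr big_ord_recr big1 => [|[i ir] _] /=; last first.
  case: ifP => [|_]; last by rewrite mulr0 oppr0.
  by move=> /= h; exfalso; move: ir h; clear; lia.
rewrite subnn subSnn mulr0 add0r expr0 expr1 mulr1.
by rewrite mulrN opprK -exprSr subrr.
Qed.

(** By symmetry of the form, the coefficient of x^a in E_r is also the coefficient of z^r in the
    one-variable dual specialization of the product of the g_(a_i), whose factors are 1, -z or 0. *)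
Lemma mcoeff_invars_nesym n r (a : 'X_{1..n}) :
  (invars n (E r))@_a =
  if [forall i, (a i <= 1)%N] && (mdeg a == r) then (-1) ^+ r else 0.
Proof.
rewrite -form_gprodE formC.
have -> : E r = \prod_(i < 1) E ([multinom r | _ < 1] i).
  by rewrite big_ord1 mnmE.
rewrite form_eprodE rmorph_prod /=.
under eq_bigr do rewrite dualvars1_g.
case: forallP => [a1|na1]; last first.
  have [i ai] : exists i, ~~ (a i <= 1)%N.
    by apply/existsP; rewrite -negb_forall; apply/forallP.
  by rewrite (bigD1 i) //= (negbTE ai) mul0r mcoeff0.
under eq_bigr do rewrite a1.
rewrite prodrXr -mdegE /= -scaleN1r exprZn mcoeffZ mpolyXn mcoeffX.
have -> : ((U_(ord0) *+ mdeg a)%MM == [multinom r | _ < 1]) = (mdeg a == r).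
  apply/eqP/eqP => [/mnmP/(_ ord0)|->].
    by rewrite mulmnE !mnmE eqxx mul1n.
  apply/mnmP => i; rewrite mulmnE !mnmE (_ : (ord0 == i) = true) ?mul1n //.
  by apply/eqP; rewrite (ord1 i).
by case: eqP => [->|_]; rewrite ?mulr1 ?mulr0.
Qed.

Lemma invars_nesym_full m : invars m (E m) = (-1) ^+ m *: 'X_[[multinom 1%N | _ < m]].
Proof.
apply/mpolyP => a; rewrite mcoeff_invars_nesym mcoeffZ mcoeffX.
have -> : ([multinom 1%N | _ < m] == a) = [forall i, (a i <= 1)%N] && (mdeg a == m).
  apply/eqP/andP => [<-|[/forallP a1 /eqP da]].
    split; first by apply/forallP => i; rewrite mnmE.
    rewrite mdegE; under eq_bigr do rewrite mnmE.
    by rewrite sum1_card card_ord.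
  apply/mnmP => i; rewrite mnmE; apply/eqP; rewrite eqn_leq a1 andbT lt0n.
  apply/negP => /eqP ai; move: da; rewrite mdegE (bigD1 i) //= ai add0n => da.
  have : (\sum_(j < m | j != i) a j <= \sum_(j < m | j != i) 1)%N by apply: leq_sum.
  rewrite da sum1_card; have := cardC1 i; rewrite card_ord => ->.
  by have := ltn_ord i; lia.
by case: ifP; rewrite ?mulr1 ?mulr0.
Qed.

(* Extracting z_1 ... z_m from the product with e_m(z_1, ..., z_m). *)
Lemma form_eprod_g be f : all (leq 1) be ->
  B (eprod be) (g (size be) * f) =
  (-1) ^+ size be * B (eprod [seq b.-1 | b <- be]) f.
Proof.
move=> be1; rewrite form_eprod rmorphM /= dualvars_g invars_nesym_full.
rewrite -scalerAl mcoeffZ; congr (_ * _).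
have -> : eprod [seq b.-1 | b <- be] =
  \prod_(i < size be) E ((seqmn be - [multinom 1%N | _ < size be])%MM i).
  rewrite /eprod big_map (big_nth 0%N) big_mkord; apply: eq_bigr => i _.
  by rewrite mnmBE !mnmE subn1.
rewrite form_eprodE mulrC.
have le : ([multinom 1%N | _ < size be] <= seqmn be)%MM.
  apply/mnm_lepP => i; rewrite !mnmE.
  by apply: (allP be1); apply: mem_nth.
by rewrite -{1}(submK le) addmC mcoeffMX.
Qed.

(** Each factor E_b uses a variable at most once, so [eprod be] takes at most min(a_i, size be) from
    the exponent a_i. *)
Lemma mcoeff_invars_eprodM n be h (a : 'X_{1..n}) :
  (invars n (eprod be * h))@_a != 0 ->
  (sumn be <= \sum_(i < n) minn (a i) (size be))%N.
Proof.
elim: be a => [|b be IH] a //=.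
rewrite /eprod big_cons -mulrA rmorphM /= => nz.
have : a \in msupp (invars n (E b) * invars n (eprod be * h)).
  by rewrite mcoeff_msupp.
case/msuppM_le/allpairsP => -[u v] /= [].
rewrite !mcoeff_msupp mcoeff_invars_nesym => ub /IH vb ->.
move: ub; case: ifP => [/andP[/forallP u1 /eqP <-] _|_]; last by rewrite eqxx.
rewrite mdegE (leq_trans (leq_add (leqnn _) vb)) // -big_split /=.
by apply: leq_sum => i _; rewrite mnmDE; have := u1 i; lia.
Qed.

Lemma gprod_cat al al' : gprod (al ++ al') = gprod al * gprod al'.
Proof. exact: big_cat. Qed.

Lemma gprod_nil : gprod [::] = 1.
Proof. exact: big_nil. Qed.

Lemma eprod_nil : eprod [::] = 1.
Proof. exact: big_nil. Qed.

Lemma gprod_cons a al : gprod (a :: al) = g a * gprod al.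
Proof. exact: big_cons. Qed.

Lemma eprod_cat be be' : eprod (be ++ be') = eprod be * eprod be'.
Proof. exact: big_cat. Qed.

Lemma eprod_cons b be : eprod (b :: be) = E b * eprod be.
Proof. exact: big_cons. Qed.

Lemma eprod_zero be : all (pred1 0%N) be -> eprod be = 1.
Proof.
by rewrite /eprod => /allP be0; rewrite big_seq big1 // => b /be0 /eqP ->.
Qed.

Lemma gprod_perm al al' : perm_eq al al' -> gprod al = gprod al'.
Proof. exact: perm_big. Qed.

Lemma gprod_filter0 al : gprod [seq a <- al | a != 0%N] = gprod al.
Proof.
rewrite /gprod big_filter big_mkcond; apply: eq_bigr => a _.
by case: eqP => [->|].
Qed.

(** The g_n generate the algebra: c_k being nonzero, Newton's identity gives p_k from g_k and terms
    of lower index. *)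
Lemma gprod_span_ind (Pr : A -> Prop) :
  Pr 0 -> (forall f h, Pr f -> Pr h -> Pr (f + h)) ->
  (forall (x : K) f, Pr f -> Pr (x *: f)) ->
  (forall al, Pr (gprod al)) -> forall f, Pr f.
Proof.
move=> P0 PD PZ PG.
pose S f := exists r : seq (K * seq nat), f = \sum_(x <- r) x.1 *: gprod x.2.
have SP f : S f -> Pr f.
  by case=> r ->; elim/big_ind: _ => // x _; apply: PZ.
have S0 : S 0 by exists [::]; rewrite big_nil.
have SD f h : S f -> S h -> S (f + h).
  by move=> [r ->] [s ->]; exists (r ++ s); rewrite big_cat.
have SZ (x : K) f : S f -> S (x *: f).
  move=> [r ->]; exists [seq (x * y.1, y.2) | y <- r].
  by rewrite big_map scaler_sumr; apply: eq_bigr => y _; rewrite scalerA.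
have SG al : S (gprod al) by exists [:: (1, al)]; rewrite big_seq1 scale1r.
have SS I (r : seq I) (F : I -> A) : (forall i, S (F i)) -> S (\sum_(i <- r) F i).
  by move=> SF; elim/big_ind: _.
have SM f h : S f -> S h -> S (f * h).
  move=> [r ->] [s ->]; rewrite mulr_suml; apply: (SS) => x.
  rewrite mulr_sumr; apply: (SS) => y.
  by rewrite -scalerAl -scalerAr -gprod_cat; apply: (SZ); apply: (SZ).
have Sg a : S (g a) by have := SG [:: a]; rewrite /gprod big_seq1.
have Sp k : S (p k.+1).
  elim/ltn_ind: k => k IH.
  have := hplethS p char0 (fun k => (c k)^-1) k; rewrite big_ord_recr /= subnn mulr1.
  move=> Ek.
  have -> : p k.+1 = c k.+1 *: (k.+1%:R *: g k.+1 + (-1) *: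
      (\sum_(i < k) (c i.+1)^-1 *: (p i.+1 * g (k - i)))).
    rewrite /g Ek scaleN1r addrAC subrr add0r scalerA mulfV ?scale1r //.
    exact: qt_ratio_neq0.
  apply/(SZ)/(SD); first exact/SZ.
  apply: (SZ); elim/big_ind: _ => // i _; apply: (SZ); apply: (SM) => //.
  exact: IH.
move=> f; apply: (SP); elim/symalg_ind: f => // [|k f Sf].
  by have := SG [::]; rewrite /gprod big_nil.
exact: SM.
Qed.

Lemma form_gprod_inj f : (forall al, B (gprod al) f = 0) -> f = 0.
Proof.
move=> Bf; apply: (form_nondeg char0 qt_ratio_neq0) => h.
elim/gprod_span_ind: h => [|h h' IH IH'|x h IH|al] //.
- exact: form0l.
- by rewrite formDl IH IH' addr0.
- by rewrite formZl IH mulr0.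
Qed.

(** Degree is tested on the restrictions to finitely many variables, the form in which the P_la are
    described. *)
Definition homsym d f := forall n, invars n f \is d.-homog.

Lemma homsymM d e f h : homsym d f -> homsym e h -> homsym (d + e) (f * h).
Proof. by move=> df eh n; rewrite rmorphM; apply: dhomogM; [exact: df | exact: eh]. Qed.

Lemma homsymZ d x f : homsym d f -> homsym d (x *: f).
Proof. by move=> df n; rewrite invarsZ; apply: dhomogZ; exact: df. Qed.

Lemma homsym_sum d I (r : seq I) (Q : pred I) (F : I -> A) :
  (forall i, Q i -> homsym d (F i)) -> homsym d (\sum_(i <- r | Q i) F i).
Proof. by move=> dF n; rewrite rmorph_sum; apply: rpred_sum => i Qi; exact: dF. Qed.

Lemma homsymB d f h : homsym d f -> homsym d h -> homsym d (f - h).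
Proof. by move=> df dh n; rewrite rmorphB; apply: rpredB; [exact: df | exact: dh]. Qed.

Lemma homsym_hpleth w d : homsym d (hpleth p w d).
Proof.
elim/ltn_ind: d => -[_|d IH]; first by move=> n; rewrite rmorph1 dhomog1.
have -> : hpleth p w d.+1 = d.+1%:R^-1 *: (d.+1%:R *: hpleth p w d.+1).
  by rewrite scalerA mulVf // scale1r.
apply: homsymZ; rewrite hplethS //; apply: homsym_sum => i _; apply: homsymZ.
have := leq_ord i; move: (nat_of_ord i) => j jd {i}.
have -> : d.+1 = (j.+1 + (d - j))%N by rewrite addSn subnKC.
apply: homsymM; last by apply: IH; rewrite ltnS leq_subr.
move=> n; rewrite /invars ev_ps //; apply: rpred_sum => i _.
by rewrite mpolyXn dhomogX /= mdegMn mdeg1 mul1n.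
Qed.

Lemma homsym_gprod al : homsym (sumn al) (gprod al).
Proof.
elim: al => [|a al IH]; first by move=> n; rewrite /gprod big_nil rmorph1 dhomog1.
by rewrite /gprod big_cons; apply: homsymM => //; apply: homsym_hpleth.
Qed.

Lemma homsym_eprod be : homsym (sumn be) (eprod be).
Proof.
elim: be => [|b be IH]; first by move=> n; rewrite /eprod big_nil rmorph1 dhomog1.
by rewrite /eprod big_cons; apply: homsymM => //; apply: homsym_hpleth.
Qed.

Lemma mdeg_seqmn al : mdeg (seqmn al) = sumn al.
Proof.
rewrite mdegE sumnE (big_nth 0%N) big_mkord; apply: eq_bigr => i _.
by rewrite mnmE.
Qed.

Lemma homsym_form d f al : homsym d f -> B (gprod al) f != 0 -> sumn al = d.
Proof.
move=> df; rewrite form_gprod => nz; apply/eqP; rewrite -mdeg_seqmn.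
by apply: contraNT nz => /(dhomog_nemf_coeff (df _)) ->.
Qed.

End Kernels.

(** * Partitions *)

Section Partitions.
Implicit Types (la mu nu al be : seq nat) (j k m : nat).

(* la'_1 + ... + la'_k *)
Definition capsum k la := sumn [seq minn a k | a <- la].

(** Inclusion-exclusion: cells common to the first j rows and the first k columns lie in a j by k
    rectangle. Equality holds when the rectangle has its corner on the boundary of the diagram, as
    in [take_capsum_nth] and [take_capsum_ex]. *)
Lemma take_capsum_le j k la :
  (sumn (take j la) + capsum k la <= j * k + sumn la)%N.
Proof.
elim: la j => [|a la IH] [|j] //=; rewrite /capsum /=.
  by have := IH 0%N; rewrite /capsum take0 /=; lia.
by have := IH j; rewrite /capsum; lia.
Qed.

Lemma capsum_ge k la : all (geq k) la -> capsum k la = sumn la.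
Proof. by rewrite /capsum; elim: la => //= a la IH /andP[ak /IH->]; lia. Qed.

Lemma sorted_geq_all a la : sorted geq (a :: la) -> all (geq a) la.
Proof. by apply: order_path_min => x y z; rewrite /geq /=; lia. Qed.

Lemma take_capsum_nth j la : sorted geq la ->
  (sumn (take j la) + capsum (nth 0 la j) la = j * nth 0 la j + sumn la)%N.
Proof.
elim: la j => [|a la IH] j; first by move=> _; rewrite nth_nil muln0; case: j.
case: j => [|j] sa /=.
  by rewrite /capsum /= -/(capsum _ _) (capsum_ge (sorted_geq_all sa)); lia.
have := IH j (path_sorted sa); rewrite /capsum /=.
have : (nth 0 la j <= a)%N.
  have [jl|lj] := ltnP j (size la); last by rewrite nth_default.
  exact: (allP (sorted_geq_all sa) _ (mem_nth 0%N jl)).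
lia.
Qed.

Lemma take_capsum_ex k la : sorted geq la ->
  exists j, (sumn (take j la) + capsum k la = j * k + sumn la)%N.
Proof.
elim: la => [|a la IH] sa; first by exists 0%N.
have [ak|ka] := leqP a k.
  exists 0%N; rewrite take0 capsum_ge //= ak.
  by apply: sub_all (sorted_geq_all sa) => x; rewrite /geq /=; lia.
have [j jE] := IH (path_sorted sa); exists j.+1.
by move: jE; rewrite /capsum /=; lia.
Qed.

(** The larger sequence comes first; the order is non-strict, and equality of sizes is carried
    separately. *)
Definition dominates la mu := forall k, (sumn (take k mu) <= sumn (take k la))%N.

(** With [capsum_dominates]: conjugation reverses dominance. The inequality of [take_capsum_le] for
    one partition is compared with a case of equality for the other. *)
Lemma dominates_capsum la mu k : sorted geq mu -> sumn mu = sumn la ->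
  dominates la mu -> (capsum k la <= capsum k mu)%N.
Proof.
move=> smu E dom; have [j jE] := take_capsum_ex k smu.
by have := take_capsum_le j k la; have := dom j; lia.
Qed.

Lemma capsum_dominates la mu : sorted geq la -> sumn mu = sumn la ->
  (forall k, capsum k la <= capsum k mu)%N -> dominates la mu.
Proof.
move=> sla E M j; have := take_capsum_nth j sla.
have := take_capsum_le j (nth 0%N la j) mu.
by have := M (nth 0%N la j); lia.
Qed.

Lemma dominates_anti la mu : is_part la -> is_part mu ->
  dominates la mu -> dominates mu la -> la = mu.
Proof.
move=> pl pm d1 d2; have {d1 d2} : forall k, sumn (take k la) = sumn (take k mu).
  by move=> k; apply/eqP; rewrite eqn_leq d1 d2.
elim: la mu pl pm => [|a la IH] [|b mu] //=.
- by move=> _ /andP[_ /= /andP[b0 _]] /(_ 1%N); rewrite /= take0 /=; lia.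
- by move=> /andP[_ /= /andP[b0 _]] _ /(_ 1%N); rewrite /= take0 /=; lia.
move=> /andP[sa /= /andP[_ pa]] /andP[sb /= /andP[_ pb]] S.
have ab : a = b by have := S 1%N; rewrite /= !take0 /=; lia.
congr (_ :: _) => //; apply: IH => [||k].
- by rewrite /is_part pa (path_sorted sa).
- by rewrite /is_part pb (path_sorted sb).
by have := S k.+1; rewrite /= ab; lia.
Qed.

Lemma is_part_behead a la : is_part (a :: la) -> is_part la.
Proof. by case/andP=> sa /= /andP[_ pa]; rewrite /is_part pa (path_sorted sa). Qed.

Definition to_part al := sort geq [seq a <- al | a != 0%N].

Lemma to_partP al : is_part (to_part al).
Proof.
rewrite /is_part sort_sorted => [|x y]; last by rewrite /geq /= leq_total.
by rewrite all_sort; apply/allP => x; rewrite mem_filter lt0n => /andP[].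
Qed.

Lemma to_part_id la : is_part la -> to_part la = la.
Proof.
case/andP=> sl pl; rewrite /to_part.
have -> : [seq a <- la | a != 0%N] = la.
  by apply/all_filterP; apply: sub_all pl => x; rewrite lt0n.
by apply: sorted_sort => // x y z; rewrite /geq /=; lia.
Qed.

Lemma perm_to_part al : perm_eq (to_part al) [seq a <- al | a != 0%N].
Proof. by rewrite perm_sort. Qed.

Lemma sumn_to_part al : sumn (to_part al) = sumn al.
Proof.
rewrite (perm_sumn (perm_to_part al)); elim: al => //= a al <-.
by case: eqP => [->|].
Qed.

Lemma head_to_part i al : (0 < i)%N -> i \in al -> (i <= sumn (take 1 (to_part al)))%N.
Proof.
move=> i0 ial; have : i \in to_part al.
  by rewrite (perm_mem (perm_to_part al)) mem_filter ial -lt0n i0.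
have := to_partP al; case: (to_part al) => [|b be] // /andP[sb _].
rewrite inE /= take0 /= addn0 => /orP[/eqP->//|].
exact: (allP (sorted_geq_all sb)).
Qed.

Definition conj_seq m la := [seq conj_part la j | j <- iota 0 m].

Lemma size_conj_seq m la : size (conj_seq m la) = m.
Proof. by rewrite size_map size_iota. Qed.

Lemma nth_conj_seq m la j : (j < m)%N -> nth 0%N (conj_seq m la) j = conj_part la j.
Proof. by move=> jm; rewrite (nth_map 0%N) ?size_iota // nth_iota. Qed.

Lemma sumn_conj_seq m la : sumn (conj_seq m la) = capsum m la.
Proof.
rewrite /conj_seq /capsum; elim: m => [|m IH].
  by elim: la => //= a la <-; rewrite minn0.
rewrite -addn1 iotaD map_cat sumn_cat IH /= addn0 add0n addn1 {IH}.
elim: la => //= a la IH; rewrite /conj_part /= in IH *.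
by case: (ltnP m a) => h /=; lia.
Qed.

Lemma capsumS k la : capsum k.+1 la = (capsum k la + conj_part la k)%N.
Proof.
rewrite -!sumn_conj_seq /conj_seq -[k.+1]addn1 iotaD map_cat sumn_cat /=.
by rewrite addn0 add0n.
Qed.

Lemma take_conj_seq k m la : (k <= m)%N -> take k (conj_seq m la) = conj_seq k la.
Proof. by move=> km; rewrite -map_take take_iota (minn_idPl km). Qed.

Lemma conj_part_cons a la j : conj_part (a :: la) j = ((j < a) + conj_part la j)%N.
Proof. by []. Qed.

(** A partition of d has at most d parts, each at most d, so padding by zeros makes it one of
    finitely many tuples. *)
Definition part_bounded d (a : d.-tuple 'I_d.+1) := [seq x <- map val a | x != 0%N].

Definition parts d : seq (seq nat) :=
  undup [seq la <- map (@part_bounded d) (enum {: d.-tuple 'I_d.+1}) |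
         is_part la && (sumn la == d)].

Lemma size_part_le la : all (leq 1) la -> (size la <= sumn la)%N.
Proof. by elim: la => //= a la IH /andP[a1 /IH]; lia. Qed.

Lemma mem_sumn_le a la : a \in la -> (a <= sumn la)%N.
Proof. by elim: la => //= b la IH; rewrite inE => /orP[/eqP->|/IH]; lia. Qed.

Lemma mem_parts d la : (la \in parts d) = is_part la && (sumn la == d).
Proof.
rewrite mem_undup mem_filter andb_idr // => /andP[pl /eqP dl].
have sz : (size la <= d)%N.
  by rewrite -dl size_part_le //; case/andP: pl.
pose s := [seq inord a : 'I_d.+1 | a <- la] ++ nseq (d - size la) ord0.
have ss : size s == d by rewrite size_cat size_map size_nseq subnKC.
apply/mapP; exists (Tuple ss); first by rewrite mem_enum.
rewrite /part_bounded /= /s map_cat filter_cat -map_comp.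
have -> : [seq x <- map val (nseq (d - size la) (ord0 : 'I_d.+1)) | x != 0%N] = [::].
  by elim: (d - size la)%N.
rewrite cats0 (_ : map _ la = la).
  apply/esym/all_filterP; case/andP: pl => _; apply: sub_all => x.
  by rewrite lt0n.
rewrite -[RHS]map_id; apply/eq_in_map => a al /=; rewrite inordK //.
by rewrite ltnS -dl mem_sumn_le.
Qed.

Lemma parts_uniq d : uniq (parts d). Proof. exact: undup_uniq. Qed.

End Partitions.

Lemma mcoeff_monsym (R : comNzRingType) n mu (a : 'X_{1..n}) :
  (monsym R n mu)@_a = (perm_eq [seq d <- (a : 'X_{1..n}) | d != 0%N] mu)%:R.
Proof.
rewrite /monsym raddf_sum /=; case pa: (perm_eq _ _); last first.
  apply: big1 => b pb; rewrite mcoeffX; case: eqP => // ba.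
  by rewrite -ba pb in pa.
have da : (mdeg a < (sumn mu).+1)%N.
  rewrite ltnS -(perm_sumn pa) mdegE.
  rewrite -(big_tuple _ _ a predT id) -sumnE.
  by elim: (val (multinom_val a)) => //= x s IH; case: eqP => [->|_] /=; lia.
rewrite (bigD1 (BMultinom da)) //= mcoeffX eqxx big1 ?addr0 // => b.
case/andP=> _ ne; rewrite mcoeffX; case: eqP => // ba; case/eqP: ne.
exact/val_inj.
Qed.

(** * Macdonald polynomials *)

Section Macdonald.
Variables (K : fieldType) (A : symalg K) (q t : K).
Hypothesis char0 : forall k, k.+1%:R != 0 :> K.
Hypothesis qt_generic : forall i j, (0 < i + j)%N -> 1 - q ^+ i * t ^+ j != 0.
Implicit Types (f h : A) (al be la mu nu ka : seq nat).

Local Notation B := (qt_form q t).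
Local Notation g := (gsym A q t).
Local Notation E := (nesym A).
Local Notation gprod := (gprod A q t).
Local Notation eprod := (eprod A).

Variable P : seq nat -> A.
Hypothesis P_tri : forall la, is_part la ->
  exists (s : seq (seq nat)) (c : seq nat -> K),
    (forall mu, mu \in s -> is_part mu /\ dom_lt mu la) /\
    forall n, invars A n (P la) =
      monsym _ n la + \sum_(mu <- s) c mu *: monsym _ n mu.
Hypothesis P_orth : forall la mu, is_part la -> is_part mu -> la != mu ->
  B (P la) (P mu) = 0.

Lemma seqmnE al : [seq d <- (seqmn al : 'X_{1..size al}) | d != 0%N] =
  [seq d <- al | d != 0%N].
Proof.
congr filter.
apply: (@eq_from_nth _ 0%N); first by rewrite size_tuple.
move=> i; rewrite size_tuple => ia.
have -> : nth 0%N (multinom_val (seqmn al)) i = seqmn al (Ordinal ia).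
  by rewrite (mnm_nth 0%N).
by rewrite mnmE.
Qed.

Lemma perm_part al mu : is_part mu ->
  perm_eq [seq d <- al | d != 0%N] mu = (to_part al == mu).
Proof.
move=> pm; apply/idP/eqP => [pe|<-]; last by rewrite perm_sym perm_to_part.
apply: (sorted_eq (leT := geq)).
- by move=> x y z; rewrite /geq /=; lia.
- by move=> x y; rewrite /geq /=; lia.
- by case/andP: (to_partP al).
- by case/andP: pm.
exact: perm_trans (perm_to_part al) pe.
Qed.

Lemma form_gprodP al la : is_part la ->
  B (gprod al) (P la) != 0 ->
  sumn al = sumn la /\ dominates la (to_part al).
Proof.
move=> pl; have [s [c [sP PE]]] := P_tri pl.
rewrite form_gprod // PE mcoeffD mcoeff_monsym seqmnE perm_part //.
case: (to_part al =P la) => [<- _|ne]; first by rewrite sumn_to_part; split.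
rewrite add0r raddf_sum /= => nz.
have /hasP[mu mus /andP[/eqP al_mu _]] :
    has (fun mu => (to_part al == mu) && (c mu != 0)) s.
  apply: contraNT nz => /hasPn ns.
  rewrite big_seq big1 // => mu mus; rewrite mcoeffZ mcoeff_monsym seqmnE.
  have [pm _] := sP _ mus; rewrite perm_part //.
  have := ns _ mus; rewrite negb_and negbK.
  by case: eqP => _ /=; rewrite ?mulr0 //= => /eqP->; rewrite mul0r.
have [pm [_ sE dom]] := sP _ mus.
by rewrite -sE -al_mu sumn_to_part; split => // k; rewrite al_mu.
Qed.

Lemma form_gprodPP la : is_part la -> B (gprod la) (P la) = 1.
Proof.
move=> pl; have [s [c [sP PE]]] := P_tri pl.
rewrite form_gprod // PE mcoeffD mcoeff_monsym seqmnE perm_part //.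
rewrite to_part_id // eqxx raddf_sum /= big_seq big1 ?addr0 // => mu mus.
have [pm [ne _ _]] := sP _ mus.
rewrite mcoeffZ mcoeff_monsym seqmnE perm_part // to_part_id // eq_sym.
by rewrite (negbTE ne) mulr0.
Qed.

Lemma homsym_monsym (n : nat) mu : monsym K n mu \is (sumn mu).-homog.
Proof.
rewrite /monsym; apply: rpred_sum => -[a /= _] /perm_sumn <-.
rewrite dhomogX /= mdegE; apply/eqP.
rewrite -(big_tuple _ _ a predT id) -sumnE.
by elim: (val (multinom_val a)) => //= x s ->; case: eqP => [->|].
Qed.

Lemma homsymP la : is_part la -> homsym (sumn la) (P la).
Proof.
move=> pl n; have [s [c [sP ->]]] := P_tri pl.
apply: rpredD; first exact: homsym_monsym.
rewrite big_seq; apply: rpred_sum => mu mus; apply: rpredZ.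
by have [_ [_ <- _]] := sP _ mus; apply: homsym_monsym.
Qed.

(** * Triangular expansions in a fixed degree *)

Section Degree.
Variable d : nat.

(** Like [cap_weight], a number strictly monotone for dominance (increasing here, decreasing for
    [cap_weight]), so that induction along the partial order becomes induction on integers. *)
Definition dom_weight la := (\sum_(k < d.+1) sumn (take k la))%N.
Definition cap_weight la := (\sum_(k < d.+1) capsum k la)%N.

Lemma part_size la : la \in parts d -> (size la <= d)%N.
Proof.
rewrite mem_parts => /andP[/andP[_ pl] /eqP <-]; exact: size_part_le.
Qed.

Lemma part_geq la k : la \in parts d -> (d <= k)%N -> all (geq k) la.
Proof.
rewrite mem_parts => /andP[_ /eqP dl] dk; apply/allP => a /mem_sumn_le.
by rewrite /geq /= dl; lia.
Qed.

Lemma dom_weight_lt la mu : la \in parts d -> mu \in parts d ->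
  dominates la mu -> la != mu -> (dom_weight mu < dom_weight la)%N.
Proof.
move=> pl pm dom ne; rewrite ltnNge; apply: contraNN ne => le.
apply/eqP; apply: dominates_anti => //.
- by move: pl; rewrite mem_parts => /andP[].
- by move: pm; rewrite mem_parts => /andP[].
move=> k; have [kd|dk] := ltnP k d.+1; last first.
  rewrite !take_oversize ?(leq_trans (part_size _)) ?(ltnW dk) //.
  by move: pl pm; rewrite !mem_parts => /andP[_ /eqP->] /andP[_ /eqP->].
rewrite leqNgt; apply/negP => lt; move: le; apply/negP; rewrite -ltnNge.
rewrite /dom_weight (bigD1 (Ordinal kd)) //= [X in (_ < X)%N](bigD1 (Ordinal kd)) //=.
by rewrite -addSn leq_add // leq_sum.
Qed.

Lemma cap_weight_lt la mu : la \in parts d -> mu \in parts d ->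
  (forall k, capsum k la <= capsum k mu)%N -> la != mu ->
  (cap_weight la < cap_weight mu)%N.
Proof.
move=> pl pm M ne; rewrite ltnNge; apply: contraNN ne => le.
have [/andP[ppl dl] /andP[ppm dm]] : is_part la && (sumn la == d) /\
    is_part mu && (sumn mu == d) by rewrite -!mem_parts.
have E' : sumn mu = sumn la by rewrite (eqP dl) (eqP dm).
have [sl sm] : sorted geq la /\ sorted geq mu.
  by case/andP: ppl => -> _; case/andP: ppm.
apply/eqP; apply: dominates_anti => //; first exact: capsum_dominates.
apply: capsum_dominates => // k; have [kd|dk] := ltnP k d.+1; last first.
  by rewrite !capsum_ge ?E' // part_geq // ltnW.
rewrite leqNgt; apply/negP => lt; move: le; apply/negP; rewrite -ltnNge.
rewrite /cap_weight (bigD1 (Ordinal kd)) //= [X in (_ < X)%N](bigD1 (Ordinal kd)) //=.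
by rewrite -addSn leq_add // leq_sum.
Qed.

Lemma downward_ind (w : seq nat -> nat) (Q : seq nat -> Prop) :
  (forall nu, nu \in parts d ->
     (forall ka, ka \in parts d -> (w nu < w ka)%N -> Q ka) -> Q nu) ->
  forall nu, nu \in parts d -> Q nu.
Proof.
move=> step; pose M := (\max_(nu <- parts d) w nu)%N.
have wM nu : nu \in parts d -> (w nu <= M)%N.
  by move=> pn; rewrite /M (big_rem nu) //= leq_maxl.
suff: forall n nu, nu \in parts d -> (M - w nu)%N = n -> Q nu.
  by move=> H nu pn; apply: (H _ nu pn erefl).
elim/ltn_ind => n IH nu pn nE; apply: step => // ka pk lt.
by apply: (IH (M - w ka)%N) => //; have := wM _ pk; lia.
Qed.

(** Only P_ka with ka above nu has x^nu, with coefficient 1 at ka = nu. On the up-set U the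
    coefficients can thus be peeled off from the top. *)
Lemma dominance_triangular (b : seq nat -> K) (U : seq nat -> Prop) :
  (forall nu mu, nu \in parts d -> mu \in parts d ->
     U nu -> dominates mu nu -> U mu) ->
  (forall nu, nu \in parts d -> U nu ->
     \sum_(ka <- parts d) b ka * B (gprod nu) (P ka) = 0) ->
  forall nu, nu \in parts d -> U nu -> b nu = 0.
Proof.
move=> up Ub; apply: (downward_ind (w := dom_weight)) => nu pn IH Un.
have := Ub nu pn Un; rewrite (bigD1_seq nu) ?parts_uniq //=.
have ppn : is_part nu by move: pn; rewrite mem_parts => /andP[].
rewrite form_gprodPP // mulr1 big_seq_cond big1 ?addr0 // => ka /andP[pk ne].
have ppk : is_part ka by move: pk; rewrite mem_parts => /andP[].
have [->|/(form_gprodP ppk)[_]] := eqVneq (B (gprod nu) (P ka)) 0.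
  by rewrite mulr0.
rewrite to_part_id // => dom; rewrite (IH ka) ?mul0r //.
  exact: dom_weight_lt.
exact: up dom.
Qed.

(** Elimination by decreasing [dom_weight]. All terms of the current top weight are subtracted at
    once; they do not interfere, since distinct comparable partitions have distinct weights. *)
Lemma P_basis f : homsym d f ->
  exists b : seq nat -> K, f = \sum_(nu <- parts d) b nu *: P nu.
Proof.
move=> df.
suff: forall n f, homsym d f -> (forall nu, nu \in parts d ->
    B (gprod nu) f != 0 -> (dom_weight nu < n)%N) ->
  exists b : seq nat -> K, f = \sum_(nu <- parts d) b nu *: P nu.
  move/(_ (\max_(nu <- parts d) dom_weight nu).+1 f df); apply => nu pn _.
  by rewrite ltnS (big_rem nu) //= leq_maxl.
elim=> [|n IH] {df}f df f0.
  exists (fun=> 0); rewrite big1 => [|nu _]; last by rewrite scale0r.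
  apply: (form_gprod_inj char0 qt_generic) => al; apply/eqP.
  apply: contraT => nz; have dal := homsym_form char0 qt_generic df nz.
  have pa : to_part al \in parts d.
    by rewrite mem_parts to_partP sumn_to_part dal eqxx.
  suff: B (gprod (to_part al)) f != 0 by move/(f0 _ pa).
  by rewrite (gprod_perm A q t (perm_to_part al)) gprod_filter0.
pose f' := f - \sum_(nu <- parts d | dom_weight nu == n) B (gprod nu) f *: P nu.
have [|ka pk nz|b bE] := IH f'.
- apply: homsymB => //; rewrite big_seq_cond; apply: homsym_sum => nu.
  rewrite mem_parts => /andP[/andP[pn /eqP <-] _]; apply: homsymZ.
  exact: homsymP.
- have kaP : is_part ka by move: pk; rewrite mem_parts => /andP[].
  have domk nu : nu \in parts d -> B (gprod ka) (P nu) != 0 -> nu != ka ->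
      (dom_weight ka < dom_weight nu)%N.
    move=> pn nz' ne; apply: dom_weight_lt => //.
    have ppn : is_part nu by move: pn; rewrite mem_parts => /andP[].
    by have [_] := form_gprodP ppn nz'; rewrite to_part_id.
  rewrite ltnNge; apply: contraNN nz => le.
  rewrite /f' formDr -scaleN1r formZr form_sumr.
  have [kn|kn] := eqVneq (dom_weight ka) n; last first.
    have lt : (n < dom_weight ka)%N by rewrite ltn_neqAle eq_sym kn.
    have -> : B (gprod ka) f = 0.
      by apply/eqP; apply: contraTT lt => /(f0 _ pk); rewrite ltnS -leqNgt.
    rewrite add0r big_seq_cond big1 ?mulr0 // => nu /andP[pn /eqP wn].
    rewrite formZr; have [->|nz'] := eqVneq (B (gprod ka) (P nu)) 0.
      by rewrite mulr0.
    have [E'|ne] := eqVneq nu ka; first by rewrite -E' wn ltnn in lt.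
    by have := domk _ pn nz' ne; rewrite wn; move: lt; lia.
  rewrite big_mkcond (bigD1_seq ka) ?parts_uniq //= kn eqxx.
  rewrite formZr form_gprodPP // mulr1 big_seq_cond big1.
    by rewrite addr0 mulN1r subrr.
  move=> nu /andP[pn ne]; case: eqP => // wn; rewrite formZr.
  have [->|nz'] := eqVneq (B (gprod ka) (P nu)) 0; first by rewrite mulr0.
  by have := domk _ pn nz' ne; rewrite wn kn ltnn.
exists (fun nu => b nu + (if dom_weight nu == n then B (gprod nu) f else 0)).
under eq_bigr do rewrite scalerDl; rewrite big_split /= -bE.
rewrite -[LHS](subrK (\sum_(nu <- parts d | dom_weight nu == n) B (gprod nu) f *: P nu)).
congr (_ + _); rewrite big_mkcond; apply: eq_bigr => nu _.
by case: eqP; rewrite ?scale0r.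
Qed.

End Degree.
End Macdonald.

(** * The Pieri coefficient of a new first row *)

Section QuasiInvariance.
Variables (K : fieldType) (q t : K).
Hypothesis qt_generic : forall i j, (0 < i + j)%N -> 1 - q ^+ i * t ^+ j != 0.

(* [c i be] is the coefficient of y^i z^be in F(y; z_1, ..., z_k), where
   F(qy; .., t z_j, ..) = F(y; z) at y = z_j for each j.  If F is homogeneous
   of degree N and involves fewer than k + 1 consecutive powers of y, then it
   vanishes. *)
Lemma quasi_invariant_vanish k (c : nat -> seq nat -> K) lo hi N :
  (forall be1 be2 n, (size be1 + size be2).+1 = k ->
     \sum_(i < n.+1) (1 - q ^+ i * t ^+ (n - i)) * c i (be1 ++ (n - i)%N :: be2) = 0) ->
  (forall i be, size be = k -> (i + sumn be = N)%N -> c i be != 0 ->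
     (lo <= i <= hi)%N) ->
  (0 < lo)%N -> (hi < lo + k)%N ->
  forall i be, size be = k -> (i + sumn be = N)%N -> c i be = 0.
Proof.
elim: k c lo hi N => [|k IH] c lo hi N rel supp lo0 hik i be sz dN.
  apply/eqP; apply: contraT => /(supp _ _ sz dN) /andP[]; lia.
case: be sz dN => // b be [sz] /= dN.
suff: forall n i b be, size be = k -> (i + (b + sumn be) = N)%N ->
  (N - (i + b))%N = n -> c i (b :: be) = 0 by move/(_ _ i b be sz dN erefl).
(* Descending induction on i + b, the joint degree in y and the first z. *)
elim/ltn_ind => n IHn {}i {}b {}be {}sz {}dN nE.
(* With b' frozen, the inner induction kills the powers of y above i', so the window is short enough
   for one variable fewer. *)
have low i' b' be' : size be' = k -> (i' + (b' + sumn be') = N)%N ->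
    (i' + b' = i + b)%N -> (i' < lo + k)%N -> c i' (b' :: be') = 0.
  move=> sz' dN' ib lt.
  apply: (IH (fun j s => c j (b' :: s)) lo i' (N - b')%N) => //; last by lia.
    by move=> be1 be2 r szr; apply: (rel (b' :: be1)); rewrite /= addSn szr.
  move=> j s szs dNs nz; have dNs' : (j + (b' + sumn s) = N)%N by lia.
  have /andP[-> _] : (lo <= j <= hi)%N by apply: (supp _ (b' :: s)); rewrite //= szs.
  rewrite leqNgt; apply: contraNN nz => lt'; apply/eqP.
  by apply: (IHn (N - (j + b'))%N) => //; lia.
have [lt|ge] := ltnP i (lo + k); first exact: low.
apply/eqP; apply: contraT => nz.
have /andP[_ ihi] : (lo <= i <= hi)%N by apply: (supp _ (b :: be)); rewrite //= sz.
(* Only i = lo + k remains. In the relation for the first variable, lower powers of y vanish by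
   [low] and higher ones by [supp]; the surviving factor 1 - q^i t^b is nonzero. *)
have := rel [::] be (i + b)%N; rewrite add0n sz => /(_ erefl).
have ib : (i < (i + b).+1)%N by rewrite ltnS leq_addr.
rewrite (bigD1 (Ordinal ib)) //= addKn big1 ?addr0.
  move/eqP; rewrite mulf_eq0 (negbTE nz) orbF (negbTE (qt_generic _)) //; lia.
move=> j ji; have jib := ltn_ord j.
have ji' : (j != i :> nat) by apply: contraNneq ji => ji; apply/eqP/val_inj.
have dNj : (j + (i + b - j + sumn be) = N)%N by lia.
have [jlt|jge] := ltnP j (lo + k); first by rewrite low ?mulr0 //; lia.
apply/eqP; rewrite mulf_eq0; apply/orP; right; apply: contraT => nzj.
have /andP[_ jhi] : (lo <= j <= hi)%N.
  by apply: (supp _ ((i + b - j)%N :: be)); rewrite //= sz.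
by move: ji'; lia.
Qed.

End QuasiInvariance.

Section PieriRow.
Variables (K : fieldType) (A : symalg K) (q t : K).
Hypothesis char0 : forall k, k.+1%:R != 0 :> K.
Hypothesis qt_generic : forall i j, (0 < i + j)%N -> 1 - q ^+ i * t ^+ j != 0.
Implicit Types (f h : A) (al be la mu nu ka : seq nat).

Local Notation B := (qt_form q t).
Local Notation g := (gsym A q t).
Local Notation E := (nesym A).
Local Notation gprod := (gprod A q t).
Local Notation eprod := (eprod A).

Variable P : seq nat -> A.
Hypothesis P_tri : forall la, is_part la ->
  exists (s : seq (seq nat)) (c : seq nat -> K),
    (forall mu, mu \in s -> is_part mu /\ dom_lt mu la) /\
    forall n, invars A n (P la) =
      monsym _ n la + \sum_(mu <- s) c mu *: monsym _ n mu.
Hypothesis P_orth : forall la mu, is_part la -> is_part mu -> la != mu ->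
  B (P la) (P mu) = 0.

Let basis d f := P_basis char0 qt_generic P_tri (d := d) (f := f).

Lemma P_nil : P [::] = 1.
Proof.
have [s [c [sP PE]]] := P_tri (la := [::]) isT.
have s0 : s = [::].
  case: s sP {PE} => // mu s /(_ mu (mem_head _ _))[/andP[_ pm] [ne E' _]].
  by case: mu pm ne E' => //= a mu /andP[a0 _] _; move: a0; case: a.
apply/eqP; rewrite -subr_eq0; apply/eqP.
apply: (form_gprod_inj char0 qt_generic) => al.
rewrite form_gprod // rmorphB rmorph1 PE s0 big_nil addr0.
rewrite mcoeffB mcoeff_monsym mcoeff1 -mdeg_eq0 mdeg_seqmn seqmnE.
rewrite perm_part // -(sumn_to_part al).
have := to_partP al; case: (to_part al) => [|a be] /=; first by rewrite subrr.
by case/andP=> _ /= /andP[a0 _]; rewrite addn_eq0 eqn0Ngt a0 subrr.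
Qed.

Lemma in_parts la : is_part la -> la \in parts (sumn la).
Proof. by rewrite mem_parts => ->/=. Qed.

Lemma parts_is_part d la : la \in parts d -> is_part la.
Proof. by rewrite mem_parts => /andP[]. Qed.

Lemma parts_sumn d la : la \in parts d -> sumn la = d.
Proof. by rewrite mem_parts => /andP[_ /eqP]. Qed.

Lemma form_expand d (b : seq nat -> K) la : la \in parts d ->
  B (\sum_(nu <- parts d) b nu *: P nu) (P la) = b la * B (P la) (P la).
Proof.
move=> pl; rewrite form_suml (bigD1_seq la) ?parts_uniq //= formZl.
rewrite big_seq_cond big1 ?addr0 // => nu /andP[pn ne].
by rewrite formZl P_orth ?mulr0 // ?(parts_is_part pn) ?(parts_is_part pl).
Qed.

Lemma form_degree d f la : homsym d f -> is_part la -> sumn la != d ->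
  B f (P la) = 0.
Proof.
move=> /basis[b ->] pl ne; rewrite form_suml big_seq big1 // => nu pn.
rewrite formZl P_orth ?mulr0 // ?(parts_is_part pn) //.
by apply: contraNneq ne => <-; rewrite (parts_sumn pn).
Qed.

Lemma norm_neq0 la : is_part la -> B (P la) (P la) != 0.
Proof.
move=> pl; apply/eqP => N0.
have P0 : P la = 0.
  apply: (form_gprod_inj char0 qt_generic) => al.
  have hom := homsym_gprod A q t char0 al.
  have [E'|ne] := eqVneq (sumn la) (sumn al); last exact: form_degree hom _ _.
  have [b ->] := basis hom; rewrite form_expand ?N0 ?mulr0 //.
  by rewrite -E' in_parts.
have := form_gprodPP char0 qt_generic P_tri pl.
by rewrite P0 form0r => /eqP; rewrite eq_sym oner_eq0.
Qed.

Lemma expandP d f : homsym d f ->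
  f = \sum_(nu <- parts d) (B f (P nu) / B (P nu) (P nu)) *: P nu.
Proof.
move=> /basis[b fE]; rewrite {1}fE big_seq [RHS]big_seq.
apply: eq_bigr => nu pn; congr (_ *: _).
by rewrite fE form_expand // mulfK // norm_neq0 // (parts_is_part pn).
Qed.

Lemma form_g_vanish i h la : is_part la -> (head 0 la < i)%N ->
  B (g i * h) (P la) = 0.
Proof.
move=> pl lt; move: h; apply: (gprod_span_ind (A := A) char0 qt_generic).
- by rewrite mulr0 form0l.
- by move=> f h IHf IHh; rewrite mulrDr formDl IHf IHh addr0.
- by move=> x f IH; rewrite -scalerAr formZl IH mulr0.
move=> al; have -> : g i * gprod al = gprod (i :: al) by rewrite gprod_cons.
apply/eqP; apply: contraT => /(form_gprodP char0 qt_generic P_tri pl)[_ /(_ 1%N)].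
have := @head_to_part i (i :: al); rewrite mem_head => /(_ _ isT).
by case: (la) lt => [|a la'] /=; rewrite ?take0 /=; lia.
Qed.

(** Since [capsum] decreases along dominance, the condition on la defines an up-set. There the
    product has no x^la by [mcoeff_invars_eprodM], and triangularity carries this over to its
    expansion in the P_nu. *)
Lemma form_e_vanish be h la : is_part la -> (capsum (size be) la < sumn be)%N ->
  B (eprod be * h) (P la) = 0.
Proof.
move=> pl lt; move: h; apply: (gprod_span_ind (A := A) char0 qt_generic).
- by rewrite mulr0 form0l.
- by move=> f h IHf IHh; rewrite mulrDr formDl IHf IHh addr0.
- by move=> x f IH; rewrite -scalerAr formZl IH mulr0.
move=> al; set f := _ * _.
have hom : homsym (sumn be + sumn al) f.
  by apply: homsymM; [exact: homsym_eprod | exact: homsym_gprod].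
have [E'|ne] := eqVneq (sumn la) (sumn be + sumn al)%N; last exact: form_degree hom _ _.
have [b fE] := basis hom.
have pla : la \in parts (sumn be + sumn al) by rewrite mem_parts pl E' eqxx.
rewrite fE form_expand // (_ : b la = 0) ?mul0r //.
refine (dominance_triangular char0 qt_generic P_tri (b := b)
  (U := fun nu => capsum (size be) nu < sumn be)%N _ _ _ pla lt).
  move=> nu mu pn pm Un dom; apply: leq_ltn_trans Un.
  apply: dominates_capsum => //; last by rewrite !(parts_sumn pn, parts_sumn pm).
  by case/andP: (parts_is_part pn).
move=> nu pn Un.
transitivity (B (gprod nu) f).
  by rewrite fE form_sumr; apply: eq_bigr => ka _; rewrite formZr.
rewrite form_gprod //; apply/eqP; apply: contraT => /mcoeff_invars_eprodM.
move/(_ q t char0 qt_generic) => le; move: Un; rewrite ltnNge (leq_trans le) //.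
rewrite /capsum sumnE big_map (big_nth 0%N) big_mkord.
by apply: leq_sum => i _; rewrite mnmE.
Qed.

Lemma form_gsym_nesym (f : A) la n :
  \sum_(i < n.+1) (1 - q ^+ i * t ^+ (n - i)) *
    B (g i * (E (n - i) * f)) (P la) = 0.
Proof.
have := congr1 (fun x => B (x * f) (P la)) (gsym_nesym A char0 qt_generic n).
rewrite mul0r form0l mulr_suml form_suml => E0; rewrite -[RHS]E0.
by apply: eq_bigr => i _; rewrite -scalerAl formZl mulrA.
Qed.

(** With k = size be, this bounds the joint degree in y and k of the z's by m + mu'_1 + ... + mu'_k,
    which is k less than the sum of the separate bounds. Beyond it, the separate bounds confine the
    exponent of y to a window of at most k values, all positive, and [quasi_invariant_vanish]
    applies. *)
Lemma form_ge_vanish m mu be h i :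
  is_part (m :: mu) -> (size be <= m)%N ->
  (m + capsum (size be) (m :: mu) < i + sumn be + size be)%N ->
  B (g i * eprod be * h) (P (m :: mu)) = 0.
Proof.
move=> pl szm lt; set la := m :: mu in pl lt *; set k := size be.
pose N := (i + sumn be)%N.
apply: (@quasi_invariant_vanish _ q t qt_generic k
  (fun i be => B (g i * eprod be * h) (P la)) (N - capsum k la) m N) => //.
- move=> be1 be2 n _.
  rewrite -[RHS](form_gsym_nesym (eprod be1 * eprod be2 * h) la n).
  apply: eq_bigr => j _; congr (_ * B _ _).
  by rewrite eprod_cat eprod_cons; ring.
- move=> j s szs dN nz; apply/andP; split.
    rewrite leqNgt; apply: contraNN nz => ltj; apply/eqP.
    rewrite mulrAC mulrC form_e_vanish // szs; move: dN ltj; rewrite /N; lia.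
  rewrite leqNgt; apply: contraNN nz => ltj.
  by rewrite -mulrA form_g_vanish.
- by rewrite /N; move: lt szm; rewrite -/k; lia.
by rewrite /N; move: lt szm; rewrite -/k; lia.
Qed.

(** The coefficient of z^{la'} in the dual specialization of P_la. Taking |la| columns only pads la'
    by zeros, that is, by factors E_0 = 1. *)
Definition cnorm la := B (eprod (conj_seq (sumn la) la)) (P la).

Lemma conj_part0 la j : all (geq j) la -> conj_part la j = 0%N.
Proof.
rewrite /conj_part => aj; apply/eqP; rewrite -leqn0 leqNgt -has_count -all_predC.
by apply: sub_all aj => x; rewrite /geq /=; lia.
Qed.

Lemma eprod_conj_seqD la m e : all (geq m) la ->
  eprod (conj_seq (m + e) la) = eprod (conj_seq m la).
Proof.
move=> am; rewrite /conj_seq iotaD map_cat eprod_cat add0n.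
rewrite [X in _ * X]eprod_zero ?mulr1 // all_map; apply/allP => j.
rewrite mem_iota => /andP[mj _] /=; rewrite conj_part0 //.
by apply: sub_all am => x; rewrite /geq /=; lia.
Qed.

Lemma eprod_conj_seq la m : all (geq m) la ->
  eprod (conj_seq m la) = eprod (conj_seq (sumn la) la).
Proof.
move=> am; have as' : all (geq (sumn la)) la.
  by apply/allP => x; rewrite /geq /=; exact: mem_sumn_le.
have [le|lt] := leqP m (sumn la).
  by rewrite -(subnKC le) eprod_conj_seqD.
by rewrite -(subnKC (ltnW lt)) eprod_conj_seqD.
Qed.

Lemma form_conj_vanish d m nu ka k : nu \in parts d -> ka \in parts d ->
  (k <= m)%N -> (capsum k ka < capsum k nu)%N ->
  B (eprod (conj_seq m nu)) (P ka) = 0.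
Proof.
move=> pn pk km lt; rewrite -(cat_take_drop k (conj_seq m nu)) eprod_cat.
rewrite take_conj_seq // form_e_vanish ?(parts_is_part pk) //.
by rewrite size_conj_seq sumn_conj_seq.
Qed.

(** Triangularity opposite to that of [gprod]: the product of the E's indexed by nu' pairs only with
    P_ka for ka below nu. *)
Lemma form_conj_neq0 d nu ka : nu \in parts d -> ka \in parts d ->
  B (eprod (conj_seq d nu)) (P ka) != 0 ->
  forall k, (capsum k nu <= capsum k ka)%N.
Proof.
move=> pn pk nz k; have [kd|dk] := leqP k d.
  by rewrite leqNgt; apply: contraNN nz => lt; rewrite (form_conj_vanish pn pk kd lt).
rewrite !capsum_ge ?(parts_sumn pn) ?(parts_sumn pk) //.
  exact: (part_geq pk (ltnW dk)).
exact: (part_geq pn (ltnW dk)).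
Qed.

(** * Removal of the first row *)

Section Removal.
Variables (m : nat) (mu : seq nat).
Hypotheses (m0 : (0 < m)%N) (pla : is_part (m :: mu)).
Hypothesis cnorm0 : forall nu, nu \in parts (sumn mu) -> cnorm nu != 0.

Let d := sumn mu.
Let la := m :: mu.
Let pmu : is_part mu := is_part_behead pla.
(** The functional represented by the coefficient of y^m in P_la[X + y]; the numbers [a nu] are the
    coordinates of the latter in the basis P_nu. *)
Let ell h := B (g m * h) (P la).
Let a nu := ell (P nu) / B (P nu) (P nu).

Lemma head_geq : all (geq m) mu.
Proof. by case/andP: pla => /sorted_geq_all. Qed.

Lemma ell_expand h : homsym d h ->
  ell h = \sum_(nu <- parts d) a nu * B h (P nu).
Proof.
move=> dh; rewrite /ell {1}(expandP dh) mulr_sumr form_suml.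
by apply: eq_bigr => nu _; rewrite -scalerAr formZl /a /ell; ring.
Qed.

(** The nu not dominated by mu form an up-set on which [ell (gprod nu)] vanishes: either nu_1 > m,
    or (m, nu) is a partition not dominated by (m, mu). *)
Lemma ell_dominated nu : nu \in parts d -> a nu != 0 -> dominates mu nu.
Proof.
move=> pn anz k; rewrite leqNgt; apply: contraNN anz => lt; apply/eqP.
refine (dominance_triangular char0 qt_generic P_tri (b := a)
  (U := fun nu => exists k, (sumn (take k mu) < sumn (take k nu))%N) _ _ pn _).
- by move=> nu1 nu2 _ _ [k' lt'] dom; exists k'; apply: leq_trans lt' (dom _).
- move=> {k lt} {}nu {}pn [k lt]; rewrite -(ell_expand (h := gprod nu)); last first.
    by rewrite -(parts_sumn pn); exact: homsym_gprod.
  have pnu := parts_is_part pn.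
  have [lt'|le] := ltnP m (head 0%N nu).
    rewrite /ell; case: (nu) lt' => // b be lt'.
    by rewrite gprod_cons mulrCA form_g_vanish.
  have pmn : is_part (m :: nu).
    case/andP: pnu => snu pnu; apply/andP; split; last by rewrite /= m0.
    by case: (nu) le snu => //= b be -> ->.
  have -> : ell (gprod nu) = B (gprod (m :: nu)) (P la).
    by rewrite /ell gprod_cons.
  apply/eqP; apply: contraT => /(form_gprodP char0 qt_generic P_tri pla)[_ dom].
  have := dom k.+1; rewrite to_part_id //= leq_add2l => le'.
  by move: lt; rewrite ltnNge le'.
by exists k.
Qed.

(** The reverse dominance. If column k violates it, [ell] kills the product of E's for nu' by the
    joint degree bound. In its expansion the terms other than nu vanish by induction, leaving [a nu]
    times the nonzero [cnorm nu]. *)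
Lemma ell_capped nu : nu \in parts d -> a nu != 0 ->
  forall k, (capsum k nu <= capsum k mu)%N.
Proof.
move: nu; apply: (downward_ind (w := cap_weight d)) => nu pn IH anz k.
rewrite leqNgt; apply: contraNN anz => lt; apply/eqP.
have dmu : sumn mu = d by [].
have cap_le k' ka : (capsum k' ka <= sumn ka)%N.
  by have := take_capsum_le 0 k' ka; rewrite take0 /=; lia.
have km : (k < m)%N.
  rewrite ltnNge; apply: contraTN lt => mk; rewrite -leqNgt.
  rewrite (capsum_ge (la := mu)).
    by rewrite dmu -(parts_sumn pn) cap_le.
  by apply: sub_all head_geq => x; rewrite /geq /=; lia.
have kd : (k < d)%N.
  rewrite ltnNge; apply: contraTN lt => dk; rewrite -leqNgt.
  rewrite (capsum_ge (la := mu)).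
    by rewrite dmu -(parts_sumn pn) cap_le.
  by apply: (part_geq (d := d)) => //; rewrite in_parts.
have hom : homsym d (eprod (conj_seq d nu)).
  have : homsym (sumn (conj_seq d nu)) (eprod (conj_seq d nu)).
    exact: homsym_eprod.
  by rewrite sumn_conj_seq capsum_ge ?(parts_sumn pn) // (part_geq pn).
have ell0 : ell (eprod (conj_seq d nu)) = 0.
  rewrite /ell -(cat_take_drop k (conj_seq d nu)) eprod_cat mulrA.
  rewrite take_conj_seq ?(ltnW kd) // form_ge_vanish //.
    by rewrite size_conj_seq ltnW.
  rewrite size_conj_seq sumn_conj_seq /capsum /= -!/(capsum _ _).
  by move: lt km; lia.
move: ell0; rewrite (ell_expand hom) (bigD1_seq nu) ?parts_uniq //=.
rewrite big_seq_cond big1 ?addr0.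
  move/eqP; rewrite mulf_eq0 => /orP[/eqP //|].
  by rewrite -{1}(parts_sumn pn) (negbTE (cnorm0 pn)).
move=> ka /andP[pk ne]; apply/eqP; rewrite mulf_eq0 -implyNb; apply/implyP => ank.
apply: contraT => nz; have caps := form_conj_neq0 pn pk nz.
suff: (capsum k ka <= capsum k mu)%N by rewrite leqNgt (leq_trans lt (caps k)).
by apply: IH => //; apply: cap_weight_lt => //; rewrite eq_sym.
Qed.

Lemma ell_supp nu : nu \in parts d -> nu != mu -> a nu = 0.
Proof.
move=> pn; apply: contraNeq => anz; apply/eqP.
have pnu := parts_is_part pn; have snu := parts_sumn pn.
have [sn sm] : sorted geq nu /\ sorted geq mu.
  by case/andP: pnu => ->; case/andP: pmu => ->.
have E' : sumn nu = sumn mu by [].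
apply: dominates_anti => //; last exact: ell_dominated.
by apply: capsum_dominates => // k; exact: ell_capped.
Qed.

(** The support leaves a multiple of P_mu; it is 1 because x^mu in P_mu and x^(m, mu) in P_(m, mu)
    both have coefficient 1. *)
Lemma form_row_removal h : homsym d h -> B (g m * h) (P la) = B h (P mu).
Proof.
move=> dh; have E' f : homsym d f -> ell f = a mu * B f (P mu).
  move=> df; rewrite (ell_expand df) (bigD1_seq mu) ?parts_uniq ?in_parts //=.
  rewrite big_seq_cond big1 ?addr0 // => nu /andP[pn ne].
  by rewrite ell_supp // mul0r.
suff a1 : a mu = 1 by have := E' h dh; rewrite a1 mul1r.
have := E' _ (homsym_gprod A q t char0 mu).
rewrite (form_gprodPP char0 qt_generic P_tri pmu) mulr1 => <-.
by rewrite /ell -gprod_cons (form_gprodPP char0 qt_generic P_tri pla).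
Qed.

Lemma form_row_removal0 nu : nu \in parts d -> nu != mu ->
  B (g m * P nu) (P la) = 0.
Proof.
move=> pn ne; rewrite form_row_removal; last first.
  by rewrite -(parts_sumn pn); apply: (homsymP P_tri); exact: parts_is_part pn.
by rewrite P_orth // (parts_is_part pn).
Qed.

(* T_s mixes the first s columns of la with the remaining ones of mu. *)
Let T s := B (g (m - s) * eprod (take s (conj_seq m la) ++ drop s (conj_seq m mu))) (P la).

Lemma conj_seq_la j : (j < m)%N -> conj_part la j = (conj_part mu j).+1.
Proof. by move=> jm; rewrite conj_part_cons jm. Qed.

(** In the relation for the variable of column s only two terms survive: powers of y above m - s
    exceed the joint bound for s columns, and powers below m - s - 1 force too large a degree in s +
    1 of the z's. *)
Lemma T_step s : (s < m)%N ->
  (1 - q ^+ (m - s) * t ^+ conj_part mu s) * T s =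
  - ((1 - q ^+ (m - s.+1) * t ^+ (conj_part mu s).+1) * T s.+1).
Proof.
move=> sm; set x := conj_part mu s.
set H := eprod (take s (conj_seq m la)) * eprod (drop s.+1 (conj_seq m mu)).
have Ts : T s = B (g (m - s) * (E x * H)) (P la).
  rewrite /T (drop_nth 0%N) ?size_conj_seq // nth_conj_seq // eprod_cat eprod_cons.
  by congr (B _ _); rewrite /H /x; ring.
have Ts1 : T s.+1 = B (g (m - s.+1) * (E x.+1 * H)) (P la).
  rewrite /T (take_nth 0%N) ?size_conj_seq // nth_conj_seq // conj_seq_la //.
  rewrite -cats1 !eprod_cat eprod_cons eprod_nil.
  by congr (B _ _); rewrite /H /x; ring.
rewrite Ts Ts1.
have := form_gsym_nesym H la (m - s + x).
have i1 : (m - s < (m - s + x).+1)%N by lia.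
have i2 : (m - s.+1 < (m - s + x).+1)%N by lia.
rewrite (bigD1 (Ordinal i1)) //= (bigD1 (Ordinal i2)) /=; last first.
  by rewrite -val_eqE /=; lia.
rewrite addKn (_ : m - s + x - (m - s.+1) = x.+1)%N; last by lia.
rewrite big1 => [|i /andP[ne1 ne2]].
  by rewrite addr0 => /eqP; rewrite addr_eq0 => /eqP.
move: ne1 ne2; rewrite -!val_eqE /= => ne1 ne2.
apply/eqP; rewrite mulf_eq0; apply/orP; right; apply/eqP.
have szs : size (take s (conj_seq m la)) = s.
  by rewrite size_take size_conj_seq sm.
have sums : sumn (take s (conj_seq m la)) = capsum s la.
  by rewrite take_conj_seq ?sumn_conj_seq // ltnW.
have [lt|le] := ltnP (m - s) i.
  have -> : g i * (E (m - s + x - i) * H) =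
      g i * eprod (take s (conj_seq m la)) *
      (E (m - s + x - i) * eprod (drop s.+1 (conj_seq m mu))).
    by rewrite /H; ring.
  apply: form_ge_vanish; rewrite ?szs ?sums -?/la //; first exact: ltnW.
  by move: lt sm; clear; lia.
have lt : (i < m - s.+1)%N by lia.
have -> : g i * (E (m - s + x - i) * H) =
    eprod (rcons (take s (conj_seq m la)) (m - s + x - i)%N) *
    (g i * eprod (drop s.+1 (conj_seq m mu))).
  by rewrite -cats1 eprod_cat eprod_cons eprod_nil; rewrite /H; ring.
apply: form_e_vanish => //; rewrite size_rcons szs sumn_rcons sums.
by rewrite capsumS conj_seq_la // -/x; move: lt; clear; lia.
Qed.

Lemma T_prod s : (s <= m)%N ->
  T 0 * \prod_(j < s) (1 - q ^+ (m - j) * t ^+ conj_part mu j) =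
  (-1) ^+ s * \prod_(j < s) (1 - q ^+ (m - j.+1) * t ^+ (conj_part mu j).+1) * T s.
Proof.
elim: s => [|s IH] sm; first by rewrite !big_ord0 expr0 !mulr1 mul1r.
have alg (X Y T0 Ts Ts1 a1 a2 sg : K) : T0 * Y = sg * X * Ts ->
    a1 * Ts = - (a2 * Ts1) -> T0 * (Y * a1) = -1 * sg * (X * a2) * Ts1.
  move=> e1 e2; transitivity (sg * X * (a1 * Ts)); last by rewrite e2; ring.
  by rewrite mulrA e1; ring.
rewrite !big_ord_recr exprS /=; apply: (alg _ _ _ _ _ _ _ _ _ (T_step sm)).
exact: IH (ltnW sm).
Qed.

Lemma cap_la_mu : all (geq m) la.
Proof. by rewrite /= head_geq /geq /= leqnn. Qed.

Lemma T_first : T 0 = cnorm mu.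
Proof.
rewrite /T take0 drop0 subn0 form_row_removal.
  by rewrite /cnorm -(eprod_conj_seq head_geq).
have : homsym (sumn (conj_seq m mu)) (eprod (conj_seq m mu)).
  exact: homsym_eprod.
by rewrite sumn_conj_seq capsum_ge // head_geq.
Qed.

Lemma T_last : T m = cnorm la.
Proof.
rewrite /T subnn take_oversize ?size_conj_seq // drop_oversize ?size_conj_seq //.
by rewrite cats0 /cnorm mul1r -(eprod_conj_seq cap_la_mu).
Qed.

Lemma row_factor_neq0 : \prod_(j < m) (1 - q ^+ (m - j) * t ^+ conj_part mu j) != 0.
Proof.
by apply/prodf_neq0 => j _; apply: qt_generic; have := ltn_ord j; lia.
Qed.

Lemma cnorm_la_neq0 : cnorm la != 0.
Proof.
have := T_prod (leqnn m); rewrite T_first T_last => E'.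
have : cnorm mu * \prod_(j < m) (1 - q ^+ (m - j) * t ^+ conj_part mu j) != 0.
  by rewrite mulf_neq0 ?row_factor_neq0 // cnorm0 // in_parts.
by rewrite E' mulf_eq0 negb_or => /andP[].
Qed.

End Removal.

Lemma cnorm_neq0 la : is_part la -> cnorm la != 0.
Proof.
move: {2}(sumn la) (erefl (sumn la)) => n; elim/ltn_ind: n la => n IH [|m mu] nE pl.
  have := form_gprodPP char0 qt_generic P_tri (la := [::]) isT.
  by rewrite /cnorm /= eprod_nil gprod_nil => ->; exact: oner_neq0.
apply: cnorm_la_neq0 => //; first by case/andP: pl => _ /= /andP[].
move=> nu pn; apply: (IH (sumn mu)); rewrite ?(parts_sumn pn) ?(parts_is_part pn) //.
by rewrite -nE /=; case/andP: pl => _ /= /andP[]; lia.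
Qed.

(** Constituents with first row shorter than m fall to the bound on g_m, those with first row m to
    row removal and orthogonality. The last coefficient is found by pairing with the E's for the
    columns of (m, mu): [form_eprod_g] shortens each column by one, giving [cnorm mu] up to sign,
    and [T_prod] compares it with [cnorm (m :: mu)]. *)
Lemma pieri_row m mu : (0 < m)%N -> is_part (m :: mu) ->
  exists phi : seq nat -> K,
    [/\ g m * P mu = \sum_(ka <- parts (m + sumn mu)) phi ka *: P ka,
        forall ka, ka \in parts (m + sumn mu) -> (head 0 ka <= m)%N ->
          ka != m :: mu -> phi ka = 0 &
        phi (m :: mu) * \prod_(j < m) (1 - q ^+ (m - j) * t ^+ conj_part mu j) =
        \prod_(j < m) (1 - q ^+ (m - j.+1) * t ^+ (conj_part mu j).+1)].
Proof.
move=> m0 pl; have pmu := is_part_behead pl.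
have hom : homsym (m + sumn mu) (g m * P mu).
  by apply: homsymM; [exact: homsym_hpleth | exact: (homsymP P_tri)].
pose phi ka := B (g m * P mu) (P ka) / B (P ka) (P ka).
have phi0 ka : ka \in parts (m + sumn mu) -> (head 0 ka <= m)%N ->
    ka != m :: mu -> phi ka = 0.
  move=> pk le ne; have pka := parts_is_part pk.
  have [lt|ge] := ltnP (head 0%N ka) m; first by rewrite /phi form_g_vanish ?mul0r.
  case: ka pk le ne pka ge => [|b ka] pk /= le ne pka ge; first by move: m0; lia.
  have bm : b = m by apply/eqP; rewrite eqn_leq le ge.
  move: pk ne pka; rewrite {}bm => pk ne pka {b le ge}.
  have kn : sumn ka = sumn mu by have := parts_sumn pk => /=; lia.
  rewrite /phi form_row_removal0 ?mul0r //.
  - by move=> nu pn; apply: cnorm_neq0; exact: parts_is_part pn.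
  - by rewrite kn in_parts.
  by apply: contraNneq ne => ->.
exists phi; split => //; first exact: expandP.
have homc : forall nu, nu \in parts (sumn mu) -> cnorm nu != 0.
  by move=> nu pn; apply: cnorm_neq0; exact: parts_is_part pn.
have cmu : all (geq m) mu by case/andP: pl => /sorted_geq_all.
have cla : all (geq m) (m :: mu) by rewrite /= cmu /geq /= leqnn.
have pla : m :: mu \in parts (m + sumn mu) by rewrite (in_parts pl).
have phiE : phi (m :: mu) * cnorm (m :: mu) = (-1) ^+ m * cnorm mu.
  transitivity (B (eprod (conj_seq m (m :: mu))) (g m * P mu)).
    rewrite (expandP hom) form_sumr (bigD1_seq (m :: mu)) ?parts_uniq //=.
    rewrite formZr -/(phi _) big_seq_cond big1 ?addr0.
      by rewrite /cnorm (eprod_conj_seq cla).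
    move=> ka /andP[pk ne]; rewrite formZr -/(phi _).
    have [le|lt] := leqP (head 0%N ka) m; first by rewrite phi0 // mul0r.
    (* A first row longer than m leaves fewer than |ka| cells in the first m columns. *)
    rewrite (form_conj_vanish pla pk (leqnn m)) ?mulr0 //.
    have -> : capsum m (m :: mu) = sumn ka by rewrite (capsum_ge cla) (parts_sumn pk).
    case: ka lt {pk ne} => //= b ka lt; rewrite /capsum /= -/(capsum _ _).
    by have := take_capsum_le 0 m ka; rewrite take0 /=; lia.
  have sz : size (conj_seq m (m :: mu)) = m by rewrite size_conj_seq.
  have pos : all (leq 1) (conj_seq m (m :: mu)).
    rewrite all_map; apply/allP => j; rewrite mem_iota add0n => /andP[_ jm] /=.
    by rewrite jm.
  have := form_eprod_g char0 qt_generic (P mu) pos; rewrite sz => ->.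
  congr (_ * B _ _); rewrite -(eprod_conj_seq cmu); congr eprod.
  rewrite -map_comp; apply/eq_in_map => j; rewrite mem_iota add0n => /andP[_ jm] /=.
  by rewrite jm.
have alg (x X Y N N' sg : K) : sg * sg = 1 -> x * N = sg * N' ->
    N' * X = sg * Y * N -> x * X * N = Y * N.
  move=> sg2 e1 e2; transitivity (sg * (N' * X)); first by rewrite mulrAC e1 mulrA.
  by rewrite e2 !mulrA sg2 mul1r.
apply: (mulIf (cnorm_neq0 pl)); apply: alg phiE _.
  by rewrite -exprMn mulrNN mulr1 expr1n.
have := T_prod m0 pl (leqnn m); rewrite T_first ?T_last //.
Qed.

End PieriRow.

(** * Products over cells *)

Section CellProducts.
Variable R : comNzRingType.
Implicit Types (la mu : seq nat) (F : nat * nat -> R).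

Lemma prod_cells_cons r la F :
  \prod_(b <- cells (r :: la)) F b =
  \prod_(j < r) F (0%N, j : nat) * \prod_(b <- cells la) F (b.1.+1, b.2).
Proof.
rewrite /cells /= big_cat /= big_map; congr (_ * _).
  by rewrite -(big_mkord xpredT (fun j => F (0%N, j))) /index_iota subn0.
rewrite (iotaDl 1 0) -map_comp !big_flatten !big_map; apply: eq_bigr => i _.
by rewrite !big_map.
Qed.

Lemma prod_cells_columns n la F : sorted geq la -> all (geq n) la ->
  \prod_(b <- cells la) F b = \prod_(j < n) \prod_(i < conj_part la j) F (i : nat, j : nat).
Proof.
elim: la F => [|r la IH] F srt le.
  by rewrite /cells big_nil big1 // => j _; rewrite big_ord0.
have [rn len] : (r <= n)%N /\ all (geq n) la by case/andP: le.
rewrite prod_cells_cons (IH (fun b => F (b.1.+1, b.2)) (path_sorted srt) len).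
rewrite (big_ord_widen n (fun j => F (0%N, j)) rn) big_mkcond -big_split.
apply: eq_bigr => j _; rewrite conj_part_cons; case: ifP => jr.
  by rewrite add1n big_ord_recl.
have -> : conj_part la j = 0%N.
  apply: conj_part0; apply: sub_all (sorted_geq_all srt) => x.
  by rewrite /geq /=; move: jr; lia.
by rewrite !big_ord0; exact: mulr1.
Qed.

(** Adding a first row of length m adds one cell at the foot of each of the first m columns.
    Contents depend on positions only, so this is the decomposition suited to them. *)
Lemma prod_cells_top_row m mu F : is_part (m :: mu) ->
  \prod_(b <- cells (m :: mu)) F b =
  \prod_(b <- cells mu) F b * \prod_(j < m) F (conj_part mu j, j : nat).
Proof.
case/andP=> srt _; have le := sorted_geq_all srt.
rewrite !(prod_cells_columns (n := m)) ?(path_sorted srt) //; last first.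
  by rewrite /= le /geq /= leqnn.
rewrite -big_split; apply: eq_bigr => j _.
by rewrite conj_part_cons ltn_ord add1n big_ord_recr.
Qed.

Lemma mem_cells la b : (b \in cells la) = (b.1 < size la)%N && (b.2 < nth 0 la b.1)%N.
Proof.
apply/allpairsPdep/andP => [[i [j]]|[i j]].
  by rewrite !mem_iota !add0n => -[/andP[_ il] /andP[_ jl] ->].
by exists b.1, b.2; rewrite !mem_iota !add0n; split => //; case: b {i j}.
Qed.

Lemma size_cells la : size (cells la) = sumn la.
Proof.
rewrite /cells size_allpairs_dep; congr sumn.
apply: (@eq_from_nth _ 0%N); first by rewrite size_map size_iota.
move=> i; rewrite size_map size_iota => il.
by rewrite (nth_map 0%N) ?size_iota // nth_iota // size_iota.
Qed.

End CellProducts.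

(** * Hook products and contents *)

Section Hooks.
Variables (K : fieldType) (q t : K).

Definition hook_prod la : K :=
  \prod_(b <- cells la) (1 - q ^+ arm la b * t ^+ (leg la b).+1).

(** For hooks the new cells are those of the first row: the cells of mu move down by one and keep
    their arms and legs. *)
Lemma hook_prod_cons m mu : is_part (m :: mu) ->
  hook_prod (m :: mu) =
  hook_prod mu * \prod_(j < m) (1 - q ^+ (m - j.+1) * t ^+ (conj_part mu j).+1).
Proof.
case/andP=> srt _; have le := sorted_geq_all srt.
rewrite /hook_prod prod_cells_cons mulrC; congr (_ * _).
  rewrite big_seq [RHS]big_seq; apply: eq_bigr => b; rewrite mem_cells.
  case/andP=> b1 b2; rewrite /arm /leg conj_part_cons /=.
  have -> : (b.2 < m)%N.
    by apply: leq_trans b2 _; apply: (allP le); apply: mem_nth.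
  by rewrite add1n subSS.
apply: eq_bigr => j _; rewrite /arm /leg conj_part_cons /= ltn_ord.
by rewrite add1n subn1.
Qed.

Lemma hook_prod_neq0 la :
  (forall i j, (0 < i + j)%N -> 1 - q ^+ i * t ^+ j != 0) -> hook_prod la != 0.
Proof.
move=> gen; rewrite /hook_prod prodf_seq_neq0; apply/allP => b _ /=.
by apply: gen; rewrite addnS.
Qed.

Definition content (b : nat * nat) : K := q ^+ coarm b * t ^- coleg b.

(** The eigenvalue of Delta_{1/v} cleared of its denominator v^|la|. *)
Definition content_poly la : {poly K} := \prod_(b <- cells la) ('X - (content b)%:P).

Hypotheses (q0 : q != 0) (t0 : t != 0).
Hypothesis qt_generic : forall i j, (0 < i + j)%N -> 1 - q ^+ i * t ^+ j != 0.

Lemma content_poly_eval m la :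
  (content_poly la).[q ^+ m] = \prod_(b <- cells la) (q ^+ m - content b).
Proof. by rewrite horner_prod; apply: eq_bigr => b _; rewrite hornerXsubC. Qed.

Lemma content_poly_neq0 m la : all (geq m) la -> (content_poly la).[q ^+ m] != 0.
Proof.
move=> le; rewrite content_poly_eval prodf_seq_neq0; apply/allP => b.
rewrite mem_cells => /andP[b1 b2] /=.
have bm : (b.2 < m)%N.
  by apply: leq_trans b2 _; apply: (allP le); apply: mem_nth.
rewrite (_ : _ - _ = - content b * (1 - q ^+ (m - b.2) * t ^+ b.1)).
  rewrite mulf_neq0 ?qt_generic ?oppr_eq0 //; last by lia.
  by rewrite mulf_neq0 ?invr_eq0 ?expf_neq0.
rewrite /content /coarm /coleg -{1}(subnKC (ltnW bm)) exprD.
by field; rewrite expf_neq0.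
Qed.

Lemma content_poly_eq0 m la : (m < head 0 la)%N -> (content_poly la).[q ^+ m] = 0.
Proof.
move=> lt; rewrite content_poly_eval; apply/eqP; rewrite prodf_seq_eq0.
apply/hasP; exists (0%N, m); last by rewrite /content /= expr0 invr1 mulr1 subrr.
by rewrite mem_cells /=; case: la lt.
Qed.

Lemma gamma_scalar m mu (x : K) : is_part (m :: mu) ->
  x * \prod_(j < m) (1 - q ^+ (m - j) * t ^+ conj_part mu j) =
    \prod_(j < m) (1 - q ^+ (m - j.+1) * t ^+ (conj_part mu j).+1) ->
  nabla_eigenvalue q t mu * hook_prod mu * x *
    ((content_poly (m :: mu)).[q ^+ m] / (content_poly mu).[q ^+ m]) =
  nabla_eigenvalue q t (m :: mu) * hook_prod (m :: mu).
Proof.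
move=> pl xE; have mu0 : (content_poly mu).[q ^+ m] != 0.
  by apply: content_poly_neq0; case/andP: pl => /sorted_geq_all.
rewrite hook_prod_cons // -xE /nabla_eigenvalue !content_poly_eval in mu0 *.
rewrite !(prod_cells_top_row _ pl) [X in X / _]mulrC mulfK //=.
rewrite exprD.
have -> : \prod_(j < m) (q ^+ m - content (conj_part mu j, j : nat)) =
  (-1) ^+ m * \prod_(j < m) content (conj_part mu j, j : nat) *
  \prod_(j < m) (1 - q ^+ (m - j) * t ^+ conj_part mu j).
  rewrite -[X in (-1) ^+ X](card_ord m) -prodrN -!big_split.
  apply: eq_bigr => j _ /=; rewrite /content /coarm /coleg /=.
  rewrite -{1}(subnKC (ltnW (ltn_ord j))) exprD.
  by field; rewrite expf_neq0.
by rewrite /content /=; ring.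
Qed.

End Hooks.

(** * Specialization at v = q^m *)

Lemma Delta_factor (F : fieldType) (v X Y x y : F) : v != 0 ->
  (1 - v^-1 * x * y) * (Y * X) = v^-1 * Y * ((v - x * y) * X).
Proof. by move=> v0; field. Qed.

Lemma Delta_neq0 (F : fieldType) (v X : F) n : v != 0 -> X != 0 -> v ^- n * X != 0.
Proof. by move=> v0 X0; rewrite mulf_neq0 // invr_eq0 expf_neq0. Qed.

(** The powers of v cancel: v^m comes from h_m[ZX], the others from the eigenvalues in degrees m + n
    and n. The only denominator left is the content polynomial d of mu. *)
Lemma Delta_ratio (F : fieldType) (v d E y p x : F) m n : v != 0 -> d != 0 ->
  v ^+ m * (E / (v ^- n * d) * (y * ((v ^+ m * v ^+ n)^-1 * x * p))) =
  E * y * p * (x / d).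
Proof. by move=> v0 d0; field; rewrite !expf_neq0 // d0. Qed.

Section GammaCore.
Variables (K : fieldType) (q t : K) (A : symalg K) (A' : symalg (ratv K)).
Hypotheses (q0 : q != 0) (t0 : t != 0).
Hypothesis char0 : forall k, k.+1%:R != 0 :> K.
Hypothesis qt_generic : forall i j, (0 < i + j)%N -> 1 - q ^+ i * t ^+ j != 0.
Local Notation K' := (ratv K).
Local Notation frac p := (FracField.tofrac p : K').

Definition toKv_morph : {rmorphism K -> K'} := @FracField.tofrac _ \o polyC.

Lemma toKvE (x : K) : toKv x = toKv_morph x. Proof. by []. Qed.

Lemma toKv_eq0 (x : K) : (toKv x == 0 :> K') = (x == 0).
Proof. by rewrite /toKv tofrac_eq0 polyC_eq0. Qed.

Lemma toKvM (x y : K) : toKv (x * y) = toKv x * toKv y.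
Proof. by rewrite toKvE rmorphM. Qed.

Lemma toKvV (x : K) : toKv x^-1 = (toKv x)^-1.
Proof. by rewrite toKvE fmorphV. Qed.

Lemma toKvX (x : K) n : toKv (x ^+ n) = toKv x ^+ n.
Proof. by rewrite toKvE rmorphXn. Qed.

Lemma char0v k : k.+1%:R != 0 :> K'.
Proof.
have -> : k.+1%:R = toKv k.+1%:R :> K' by rewrite toKvE rmorph_nat.
by rewrite toKv_eq0.
Qed.

Lemma vv_neq0 : vv != 0 :> K'.
Proof. by rewrite /vv tofrac_eq0 polyX_eq0. Qed.

Lemma Delta_eigenvalueE la :
  Delta_eigenvalue q t vv^-1 la =
  vv ^- sumn la * frac (content_poly q t la).
Proof.
rewrite /Delta_eigenvalue /content_poly rmorph_prod /= -size_cells.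
elim: (cells la) => [|b r IH]; first by rewrite !big_nil expr0 invr1 mulr1.
rewrite !big_cons IH /= exprS invfM rmorphB /=.
rewrite -[FracField.tofrac (content q t b)%:P]/(toKv (content q t b)).
rewrite /content toKvM toKvV !toKvX -/(@vv K).
exact: Delta_factor vv_neq0.
Qed.

Lemma content_poly_nz la : content_poly q t la != 0.
Proof. by apply/monic_neq0/monic_prod => b _; exact: monicXsubC. Qed.

Lemma Delta_eigenvalue_neq0 la : Delta_eigenvalue q t vv^-1 la != 0.
Proof.
rewrite Delta_eigenvalueE; apply: Delta_neq0; first exact: vv_neq0.
by rewrite tofrac_eq0 content_poly_nz.
Qed.

Definition scalar_ext : {rmorphism A -> A'} :=
  ev A (in_alg A' \o toKv_morph) (ps A').
Local Notation mp := scalar_ext.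

Lemma scalar_extZ (x : K) f : mp (x *: f) = toKv x *: mp f.
Proof. by rewrite /mp evZ /= -scalerAl mul1r. Qed.

Lemma pc_scalar_ext m f : pc m (mp f) = toKv (pc m f).
Proof.
elim/symalg_ind: f m => [|f h IHf IHh|x f IH||k f IH] m.
- by rewrite rmorph0 !pc0 toKvE rmorph0.
- by rewrite rmorphD !pcD IHf IHh !toKvE rmorphD.
- by rewrite scalar_extZ !pcZ IH toKvM.
- by rewrite rmorph1 !pc1 toKvE rmorph_nat.
rewrite rmorphM /= [mp (ps A _)]ev_ps //.
have [mk|mk] := eqVneq (m k) 0%N.
  by rewrite !pc_psM0 // toKvE rmorph0.
by rewrite (mul_ucmK mk) !pc_psM IH.
Qed.

Lemma scalar_ext_hpleth w n :
  mp (hpleth (ps A) w n) = hpleth (ps A') (fun k => toKv (w k)) n.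
Proof.
move: n; apply: (hpleth_uniq char0v) => [|n].
  by rewrite rmorph1.
have -> : n.+1%:R = toKv n.+1%:R :> K' by rewrite toKvE rmorph_nat.
rewrite -scalar_extZ hplethS // rmorph_sum; apply: eq_bigr => i _ /=.
by rewrite scalar_extZ rmorphM /= [mp (ps A _)]ev_ps.
Qed.

(** Links the plethystic h_n[uYX] of [hsym_u] to the Newton recursion with weights w. *)
Lemma ev_hpleth_graded (w : nat -> K') n :
  ev A' (polyC \o in_alg A') (fun k => (w k *: ps A' k)%:P * 'X^k)
     (hpleth (ps A') (fun=> 1) n) =
  (hpleth (ps A') w n)%:P * 'X^n.
Proof.
elim/ltn_ind: n => -[_|n IH]; first by rewrite rmorph1 mulr1.
set phi := ev _ _ _ in IH *.
have inv (x y : {poly A'}) : n.+1%:R%:A%:P * x = n.+1%:R%:A%:P * y -> x = y.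
  move/(congr1 ( *%R (n.+1%:R^-1)%:A%:P)).
  by rewrite !mulrA -polyCM -in_algE -rmorphM mulVf ?char0v // rmorph1 !mul1r.
apply: inv; rewrite mulrA -polyCM -scalerAl mul1r.
rewrite [in RHS]hplethS; last exact: char0v.
have <- : phi (n.+1%:R *: hpleth (ps A') (fun=> 1) n.+1) =
  n.+1%:R%:A%:P * phi (hpleth (ps A') (fun=> 1) n.+1) by rewrite /phi evZ.
rewrite hplethS; last exact: char0v.
rewrite rmorph_sum (rmorph_sum polyC) mulr_suml; apply: eq_bigr => i _ /=.
rewrite scale1r rmorphM /= [phi (ps _ _)]ev_ps // IH ?ltnS ?leq_subr //.
rewrite mulrACA -exprD addSn. rewrite subnKC; last by rewrite -ltnS.
rewrite -polyCM. by rewrite -scalerAl.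
Qed.

Variable P : seq nat -> A.
Hypothesis P_tri : forall la, is_part la ->
  exists (s : seq (seq nat)) (c : seq nat -> K),
    (forall mu, mu \in s -> is_part mu /\ dom_lt mu la) /\
    forall n, invars A n (P la) =
      monsym _ n la + \sum_(mu <- s) c mu *: monsym _ n mu.
Hypothesis P_orth : forall la mu, is_part la -> is_part mu -> la != mu ->
  qt_form q t (P la) (P mu) = 0.

Local Notation J la := (hook_prod q t la *: P la).

Variables (D : {linear A' -> A'}) (DV : A' -> A').
Hypothesis D_eig : forall la, is_part la ->
  D (mp (J la)) = Delta_eigenvalue q t vv^-1 la *: mp (J la).
Hypothesis DK : cancel D DV.

Lemma D_P la : is_part la ->
  D (mp (P la)) = Delta_eigenvalue q t vv^-1 la *: mp (P la).
Proof.
move=> pl; have h0 : toKv (hook_prod q t la) != 0.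
  by rewrite toKv_eq0 hook_prod_neq0.
apply: (scalerI h0); rewrite -linearZ -scalar_extZ D_eig //.
by rewrite scalar_extZ scalerA mulrC -scalerA.
Qed.

Lemma DV_P x la : is_part la ->
  DV (mp (x *: P la)) = (toKv x / Delta_eigenvalue q t vv^-1 la) *: mp (P la).
Proof.
(* [DV] is a bare function, so its value is found by exhibiting a preimage under [D]. *)
move=> pl; rewrite -[RHS]DK linearZ /= D_P // scalerA mulfVK ?Delta_eigenvalue_neq0 //.
by rewrite scalar_extZ.
Qed.

(** Evaluation is not additive in the presence of poles; here a common denominator, nonzero at a,
    reduces the sum to a single fraction. *)
Lemma frac_eval_sum (a : K) I (r : seq I) (y : I -> K) (p : I -> {poly K}) d :
  d.[a] != 0 ->
  frac_eval a (\sum_(i <- r) toKv (y i) * (frac (p i) / frac d)) =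
  \sum_(i <- r) y i * ((p i).[a] / d.[a]).
Proof.
move=> d0.
have -> : \sum_(i <- r) toKv (y i) * (frac (p i) / frac d) =
    frac (\sum_(i <- r) (y i)%:P * p i) / frac d.
  rewrite rmorph_sum mulr_suml; apply: eq_bigr => i _.
  by rewrite rmorphM /= -mulrA.
rewrite frac_eval_div // horner_sum mulr_suml; apply: eq_bigr => i _.
by rewrite hornerM hornerC mulrA.
Qed.

Lemma gamma_core m mu M : (0 < m)%N -> is_part (m :: mu) ->
  frac_eval (q ^+ m)
    (pc M (D ((vv ^+ m *: mp (gsym A q t m)) *
              DV (mp (nabla_eigenvalue q t mu *: J mu))))) =
  pc M (nabla_eigenvalue q t (m :: mu) *: J (m :: mu)).
Proof.
move=> m0 pl; have pmu := is_part_behead pl.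
have [phi [gP phi0 phiE]] := pieri_row char0 qt_generic P_tri P_orth m0 pl.
set e := nabla_eigenvalue q t mu; set h := hook_prod q t mu.
set d := content_poly q t mu.
have d0 : d.[q ^+ m] != 0.
  by apply: content_poly_neq0 => //; case/andP: pl => /sorted_geq_all.
rewrite scalerA DV_P // -scalerAl -scalerAr scalerA -rmorphM gP rmorph_sum.
rewrite linearZ !linear_sum /= pcZ pc_sum mulr_sumr.
rewrite (eq_big_seq (fun ka => toKv (e * h * phi ka * pc M (P ka)) *
    (frac (content_poly q t ka) / frac d))); last first.
  move=> ka pk; rewrite linearZ /= scalar_extZ linearZ /= (D_P (parts_is_part pk)).
  rewrite !pcZ pc_scalar_ext !Delta_eigenvalueE (parts_sumn pk) -/d exprD.
  rewrite (toKvM (e * h * phi ka)) (toKvM (e * h)).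
  have v0 := vv_neq0; have fd0 : frac d != 0 by rewrite tofrac_eq0 content_poly_nz.
  exact: (@Delta_ratio K' vv (frac d) (toKv (e * h)) (toKv (phi ka))
    (toKv (pc M (P ka))) (frac (content_poly q t ka)) m (sumn mu) v0 fd0).
rewrite frac_eval_sum // (bigD1_seq (m :: mu)) ?parts_uniq ?(in_parts pl) //=.
rewrite big_seq_cond big1 ?addr0.
  by rewrite pcZ -(gamma_scalar q0 t0 qt_generic pl phiE); rewrite -/e -/h -/d; ring.
move=> ka /andP[pk ne]; have [le|lt] := leqP (head 0%N ka) m.
  by rewrite phi0 // mulr0 !mul0r.
by rewrite content_poly_eq0 // mul0r mulr0.
Qed.

End GammaCore.

(** * The power-sum model *)

Section SymfunModel.
Variable K : fieldType.
Implicit Types (f g : symfun K) (m : cmonom nat).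

Local Notation mon m := (mkmalgU m (1 : K) : symfun K).

Lemma symfun_monZ m (x : K) : x *: mon m = mkmalgU m x.
Proof.
apply/monalg.malgP => m'; etransitivity; first exact: monalg.mcoeffZ.
transitivity (x *+ (m == m')); last by symmetry; exact: monalg.mcoeffU.
transitivity (x * (1 *+ (m == m'))); last by rewrite mulr_natr.
by congr (_ * _); exact: monalg.mcoeffU.
Qed.

Definition symfun_ev (S : comNzRingType) (iota : {rmorphism K -> S})
  (phi : nat -> S) : {rmorphism symfun K -> S} := pleth phi iota.

Definition symfun_alg : symalg K.
Proof.
refine (@Symalg K (symfun K) psum symfun_ev (fun m => mon m)
  (fun m f => monalg.mcoeff m f)
  (fun F f => monalg.mmap (idfun : K -> K) F f) _ _ _ _ _ _ _ _ _ _ _ _).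
- by move=> S iota phi x f; exact: plethZ.
- by move=> S iota phi k; exact: pleth_psum.
- by [].
- move=> k m; symmetry; etransitivity; first exact: fgmulUU.
  by rewrite mulr1.
- by move=> m f g; exact: monalg.mcoeffD.
- by move=> m x f; exact: monalg.mcoeffZ.
- by move=> m m'; exact: monalg.mcoeffU.
- by move=> F; exact: monalg.mmap0.
- by move=> F f g; exact: monalg.mmapD.
- by move=> F x m; rewrite symfun_monZ; exact: monalg.mmapU.
- move=> f; exists (monalg.msupp f); rewrite {1}[f]monalgE.
  by apply: eq_bigr => m _; symmetry; exact: symfun_monZ.
move=> f f0; apply/monalg.malgP => m; rewrite f0.
by symmetry; exact: monalg.mcoeff0.
Defined.

Lemma malgC_in_alg (x : K) : mkmalgU (one : cmonom nat) x = x%:A :> symfun K.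
Proof. by rewrite -symfun_monZ. Qed.

Lemma eq_pleth (S : comNzRingType) (iota iota' : K -> S) (phi : nat -> S) f :
  iota =1 iota' -> pleth phi iota f = pleth phi iota' f.
Proof.
move=> E; etransitivity; first exact: monalg.mmapE.
etransitivity; last by symmetry; exact: monalg.mmapE.
by apply: eq_bigr => m _; rewrite E.
Qed.

Lemma qt_form_hall q t f g : qt_form (A := symfun_alg) q t f g = hall_qt q t f g.
Proof.
rewrite /hall_qt /hall; etransitivity; first exact: monalg.mmapE.
apply: eq_bigr => m _.
have E := pc_scaled (A := symfun_alg) q t g m.
have -> : monalg.mcoeff m (pleth (fun k => ((1 - q ^+ k) / (1 - t ^+ k)) *: psum k)
    (mkmalgU (one : cmonom nat)) g) = pleth_mon (qt_ratio q t) m * monalg.mcoeff m g.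
  etransitivity; last exact: E.
  exact: (congr1 (monalg.mcoeff m) (eq_pleth _ _ malgC_in_alg)).
rewrite /qt_weight /=; move: (monalg.mcoeff m f) (monalg.mcoeff m g) => x y.
by ring.
Qed.

Hypothesis char0 : forall k, k.+1%:R != 0 :> K.

Lemma hsym_hpleth n : hsym K n = hpleth (ps symfun_alg) (fun=> 1) n.
Proof.
move: n; apply: (hpleth_uniq char0) => // n.
rewrite hsymS; etransitivity; first exact: scalerA.
rewrite mulfV //; etransitivity; first exact: scale1r.
by apply: eq_bigr => i _; symmetry; exact: scale1r.
Qed.

(** Stated without additivity of [fc], in view of [frac_eval]: distinct monomials of the support
    never merge. *)
Lemma mcoeff_map_symfun (F : fieldType) (fc : K -> F) f m : fc 0 = 0 ->
  monalg.mcoeff m (map_symfun fc f) = fc (monalg.mcoeff m f).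
Proof.
move=> fc0; rewrite /map_symfun.
have -> : monalg.mmap (fun c : K => mkmalgU (one : cmonom nat) (fc c) : symfun F)
    (fun m => mkmalgU m 1) f =
  \sum_(m' <- monalg.msupp f) mkmalgU m' (fc (monalg.mcoeff m' f)) :> malg (cmonom nat) F.
  etransitivity; first exact: monalg.mmapE.
  apply: eq_bigr => m' _; etransitivity; first exact: fgmulUU.
  exact: (f_equal2 (fun m x => mkmalgU m (x : F)) (mul1m m') (mulr1 (fc (monalg.mcoeff m' f)))).
rewrite raddf_sum /=.
under eq_bigr => m' _ do rewrite monalg.mcoeffU mulrb.
rewrite -big_mkcond /=; case: (boolP (m \in monalg.msupp f)) => mf.
  rewrite -big_filter (_ : [seq i <- monalg.msupp f | i == m] = [:: m]) ?big_seq1 //.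
  by rewrite filter_pred1_uniq // fset_uniq.
rewrite big_seq_cond big1 ?monalg.mcoeff_outdom ?fc0 // => m' /andP[m'f /eqP E].
by rewrite -E m'f in mf.
Qed.

End SymfunModel.

(** * The operators Gamma on the Macdonald basis *)

Section Final.
Variables (K : fieldType) (q t : K).
Hypotheses (q0 : q != 0) (t0 : t != 0).
Hypothesis char0 : forall k, k.+1%:R != 0 :> K.
Hypothesis qt_generic : forall i j, (0 < i + j)%N -> 1 - q ^+ i * t ^+ j != 0.
Local Notation K' := (ratv K).
Local Notation A := (symfun_alg K).
Local Notation A' := (symfun_alg K').
Local Notation mp := (scalar_ext A A').

Lemma frac_eval0 (a : K) : frac_eval a 0 = 0.
Proof.
have -> : 0 = FracField.tofrac 0 / FracField.tofrac 1 :> K' by rewrite rmorph0 mul0r.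
by rewrite frac_eval_div ?horner0 ?mul0r // -polyC1 hornerC oner_neq0.
Qed.

Lemma map_symfun_toKv (f : symfun K) : map_symfun toKv f = mp f.
Proof.
apply/monalg.malgP => m; transitivity (toKv (monalg.mcoeff m f)).
  apply: mcoeff_map_symfun. exact: (rmorph0 (toKv_morph K)).
symmetry. exact: (pc_scalar_ext A' m (f : A)).
Qed.

Lemma Exp_Z_gsym m : Exp_Z q t m = vv ^+ m *: mp (gsym A q t m).
Proof.
pose w k : K' := vv ^+ k * (1 - toKv t ^+ k) / (1 - toKv q ^+ k).
have hZ n : hsym_Z q t n = (hpleth (ps A') w n : symfun K')%:P * 'X^n.
  rewrite -(ev_hpleth_graded A' char0) -hsym_hpleth; last exact: char0v.
  apply: eq_pleth => x; congr polyC; exact: malgC_in_alg.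
rewrite /Exp_Z big_ord_recr /= big1 ?add0r => [|i _].
  rewrite hZ coefMXn ltnn subnn coefC eqxx.
  pose w' k := toKv (qt_ratio q t k)^-1 : K'.
  transitivity (hpleth (ps A') (fun k => vv ^+ k * w' k) m).
    apply: (eq_hpleth (ps A') (char0v char0)) => k.
    have toKvB n x : toKv (1 - x ^+ n) = 1 - toKv x ^+ n :> K'.
      by rewrite !toKvE rmorphB rmorph1 rmorphXn.
    rewrite /w /w' -mulrA; congr (_ * _).
    by rewrite toKvV /qt_ratio toKvM toKvV !toKvB invf_div.
  etransitivity; first exact: (hpleth_scale (ps A') (char0v char0) vv w' m).
  have E := scalar_ext_hpleth A A' char0 (fun k => (qt_ratio q t k)^-1) m.
  by congr (vv ^+ m *: _); symmetry; exact: E.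
by rewrite hZ coefCM coefXn gtn_eqF ?ltn_ord // mulr0.
Qed.

Variables (P : seq nat -> symfun K) (N : {linear symfun K -> symfun K})
  (NV : symfun K -> symfun K)
  (D : {linear symfun K' -> symfun K'}) (DV : symfun K' -> symfun K').
Hypothesis hP : is_macdonaldP q t P.
Hypotheses (hN : is_nabla q t P N) (NK : cancel N NV).
Hypotheses (hD : is_Delta q t P vv^-1 D) (DK : cancel D DV).

Lemma macdonaldP_unitriangular la : is_part la ->
  exists (s : seq (seq nat)) (c : seq nat -> K),
    (forall mu, mu \in s -> is_part mu /\ dom_lt mu la) /\
    forall n, invars A n (P la) =
      monsym _ n la + \sum_(mu <- s) c mu *: monsym _ n mu.
Proof. by case: hP => tri _ /tri. Qed.

Lemma macdonaldP_orthogonal la mu : is_part la -> is_part mu -> la != mu ->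
  qt_form (A := A) q t (P la) (P mu) = 0.
Proof.
by move=> pl pm ne; rewrite qt_form_hall; case: hP => _; apply.
Qed.

Lemma Gamma_plus_J m mu : is_part (m :: mu) ->
  Gamma_plus q t N NV D DV m (macdonaldJ q t P mu) = macdonaldJ q t P (m :: mu).
Proof.
move=> pl; have pmu := is_part_behead pl.
have m0 : (0 < m)%N by case/andP: pl => _ /= /andP[].
have DV0 : DV 0 = 0 by rewrite -[RHS]DK linear0.
pose X := (vv ^+ m *: mp (gsym A q t m)) *
    DV (mp (nabla_eigenvalue q t mu *: macdonaldJ q t P mu)).
(* The argument is constant in u, so only the coefficient of u^m in Exp[ZX] contributes. *)
have S : series_mul (Exp_Z q t) (series_map DV (series_map (map_symfun toKv)
    (series_map N (series_const (macdonaldJ q t P mu))))) m = X.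
  rewrite /series_mul big_ord_recr big1 => [|i _].
    etransitivity; first exact: add0r.
    rewrite /series_map /= subnn /series_const eqxx (hN pmu) map_symfun_toKv.
    by rewrite Exp_Z_gsym.
  rewrite /series_map /series_const ifF; last first.
    by apply/negbTE; rewrite subn_eq0 -ltnNge; case: i.
  by rewrite linear0 map_symfun_toKv rmorph0 DV0; exact: mulr0.
(* Writing the right side as NV (N J) allows the comparison to be made before nabla is undone. *)
rewrite -[RHS]NK; apply: (congr1 NV); rewrite (hN pl).
apply/monalg.malgP => M.
etransitivity; first by apply: mcoeff_map_symfun; exact: frac_eval0.
etransitivity; first exact: (congr1 (fun x => frac_eval _ (monalg.mcoeff M (D x))) S).
have D_eig nu : is_part nu -> D (mp (hook_prod q t nu *: P nu)) =
    Delta_eigenvalue q t vv^-1 nu *: mp (hook_prod q t nu *: P nu).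
  by move=> pn; have := hD pn; rewrite map_symfun_toKv.
have core := gamma_core (A := A) (A' := A') q0 t0 char0 qt_generic.
exact: (core _ macdonaldP_unitriangular macdonaldP_orthogonal _ _ D_eig DK m mu M m0 pl).
Qed.

Lemma macdonaldJ_nil : macdonaldJ q t P [::] = 1.
Proof.
rewrite /macdonaldJ /cells big_nil scale1r.
exact: (P_nil (A := A) char0 qt_generic macdonaldP_unitriangular).
Qed.

Lemma Gamma_plus_foldr la : is_part la ->
  foldr (Gamma_plus q t N NV D DV) 1 la = macdonaldJ q t P la.
Proof.
elim: la => [|m mu IH] pl /=; first by rewrite macdonaldJ_nil.
by rewrite (IH (is_part_behead pl)) Gamma_plus_J.
Qed.

End Final.

(** * Genericity of q and t in Q(q,t) *)

Lemma Kqt_char0 k : k.+1%:R != 0 :> Kqt.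
Proof.
have -> : k.+1%:R = FracField.tofrac k.+1%:R%:P%:P :> Kqt by rewrite !rmorph_nat.
by rewrite tofrac_eq0 !polyC_eq0 Num.Theory.pnatr_eq0.
Qed.

(** The coefficient of q^i t^j is -1, because (i, j) differs from (0, 0). *)
Lemma one_sub_XX_neq0 (R : nzRingType) i j : (0 < i + j)%N ->
  1 - ('X^i)%:P * 'X^j != 0 :> {poly {poly R}}.
Proof.
move=> ij; apply/eqP => /(congr1 (fun p : {poly {poly R}} => p`_j`_i)).
rewrite coefB coefCM coefXn eqxx mulr1 coefB coefXn eqxx coef0 coef0 coef1.
case: j ij => [|j] ij; last by rewrite coef0 => /eqP; rewrite sub0r oppr_eq0 oner_eq0.
by rewrite coef1; case: i ij => [//|i] _ /eqP; rewrite sub0r oppr_eq0 oner_eq0.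
Qed.

Lemma Kqt_generic i j : (0 < i + j)%N -> 1 - qK ^+ i * tK ^+ j != 0 :> Kqt.
Proof.
move=> ij; have -> : 1 - qK ^+ i * tK ^+ j =
    FracField.tofrac (1 - ('X^i)%:P * 'X^j) :> Kqt.
  by rewrite rmorphB rmorph1 rmorphM /qK /tK !rmorphXn.
by rewrite tofrac_eq0 one_sub_XX_neq0.
Qed.

Theorem mainTheorem1
    (P : seq nat -> symfun Kqt)
    (nabla : {linear symfun Kqt -> symfun Kqt})
    (nablaV : symfun Kqt -> symfun Kqt)
    (Delta : {linear symfun (ratv Kqt) -> symfun (ratv Kqt)})
    (DeltaV : symfun (ratv Kqt) -> symfun (ratv Kqt))
    (hP : is_macdonaldP qK tK P)
    (hnabla : is_nabla qK tK P nabla)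
    (hnablaV : cancel nabla nablaV) (hnablaV' : cancel nablaV nabla)
    (hDelta : is_Delta qK tK P vv^-1 Delta)
    (hDeltaV : cancel Delta DeltaV) (hDeltaV' : cancel DeltaV Delta)
    (la : seq nat) (hla : is_part la) :
  foldr (Gamma_plus qK tK nabla nablaV Delta DeltaV) 1 la = macdonaldJ qK tK P la.
Proof.
have q0 : qK != 0 by rewrite /qK tofrac_eq0 polyC_eq0 polyX_eq0.
have t0 : tK != 0 by rewrite /tK tofrac_eq0 polyX_eq0.
exact: (Gamma_plus_foldr q0 t0 Kqt_char0 Kqt_generic hP hnabla hnablaV hDelta hDeltaV hla).
Qed.
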